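(* Let $g\colon L^2\to\mathbb{R}^{n+2}$, $n\geq 4$, be a simply connected $1$-isotropic substantial surface, with associated ruled immersion $F_g\colon M^n\to\mathbb{R}^{n+2}$ and isometric deformations $F_\theta\colon M^n\to\mathbb{R}^{n+2}$, $\theta\in\mathbb{S}^1=[0,\pi)$. If $g$ is holomorphic with respect to some parallel complex structure of $\mathbb{R}^{n+2}$, then $F_g\circ S_{-\theta}$ is congruent to $F_\theta$ for any $\theta\in\mathbb{S}^1$; that is, there is an isometry $\tau$ of $\mathbb{R}^{n+2}$ (depending on $\theta$) with $F_\theta=\tau\circ F_g\circ S_{-\theta}$.
   Context: $g\colon L^2\to\mathbb{R}^{n+2}$ is an isometric immersion of an oriented two-dimensional Riemannian manifold with complex structure $J$, second fundamental form $\alpha_g$ and normal connection $\nabla^\perp$. A minimal $g$ is substantial if for no nonempty open $U\subset L$ is $g(U)$ contained in a proper affine subspace. $g$ is $1$-isotropic if it is minimal and at every $p$ the ellipse of curvature $\{\alpha_g(X_\psi,X_\psi): X_\psi=\cos\psi X+\sin\psi JX\}$ ($X\in T_pL$ unit) is a circle, possibly of radius $0$. Higher fundamental forms and normal spaces: $\alpha_g^2=\alpha_g$, and for $s\geq3$, $\alpha_g^s(X_1,\ldots,X_s)=\big(\nabla^\perp_{X_s}\cdots\nabla^\perp_{X_3}\alpha_g(X_2,X_1)\big)^\perp$, where $(\ )^\perp$ is the projection onto the orthogonal complement of $N_1^g\oplus\cdots\oplus N_{s-2}^g$ in the normal bundle $N_gL$, and $N_k^g(p)=\mathrm{span}\{\alpha_g^{k+1}(X_1,\ldots,X_{k+1}):X_i\in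 T_pL\}$. On an open dense subset $N_gL$ is the orthogonal sum of the $N_s^g$, and (for $g$ holomorphic, so $n$ is even) all of them are plane bundles, oriented by the ordered pair $\alpha_g^{s+1}(X,\ldots,X)$, $\alpha_g^{s+1}(JX,X,\ldots,X)$, $0\neq X\in TL$. The bundle $N_1^g$ extends smoothly over the (isolated) zeros of $\alpha_g$ to a plane bundle over $L^2$; $\Lambda_g$ is its orthogonal complement in $N_gL$. $M^n$ denotes $\Lambda_g$ with the metric induced by the immersion $F_g(p,v)=g(p)+v$. Deformations: put $J_\theta=\cos\theta\,I+\sin\theta\,J$ and let $g_\theta\colon L^2\to\mathbb{R}^{n+2}$, $g_\theta(x)=\int_{p_0}^x g_*\circ J_\theta$ ($p_0\in L^2$ fixed) be the associated family of $g$, so that $g_{\theta*}=g_*\circ J_\theta$; the normal spaces of $g$ and $g_\theta$ at a point, and all the $N_s^g$ and $N_s^{g_\theta}$, coincide as subspaces of $\mathbb{R}^{n+2}$. Then $F_\theta\colon M^n\to\mathbb{R}^{n+2}$ is $F_\theta(p,v)=g_\theta(p)+v$, which is an isometric immersion. If $g$ is holomorphic, $S_\theta\colon M^n\to M^n$ is the isometry $S_\theta(p,v)=(p,R_\theta v)$, where $R_\theta$ is the fiberwise linear map of $\Lambda_g$ acting on each oriented plane bundle $N_s^g$, $s\geq2$, as the orientation preserving rotation of angle $\theta$ (extended smoothly over points where some $N_s^g$ drops rank). *)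

(* Defs.v *)
From HB Require Import structures.
From mathcomp Require Import all_boot all_order all_algebra.
From mathcomp Require Import all_classical all_reals all_analysis.

Set Implicit Arguments.
Unset Strict Implicit.
Unset Printing Implicit Defensive.

Import Order.TTheory GRing.Theory Num.Theory.
Import numFieldNormedType.Exports.

Local Open Scope classical_set_scope.
Local Open Scope ring_scope.

Section Euclidean.
Context {R : realType} {N : nat}.
Implicit Types (u v w : 'rV[R]_N) (V : {vspace 'rV[R]_N}).

(* The norm that the library puts on row vectors is the sup norm; it is used
   here only for its topology and for derivatives. *)
Definition dot u v : R := (u *m v^T) 0 0.
Definition enorm u : R := Num.sqrt (dot u u).

Definition orthonormal_pair u v := [/\ dot u u = 1, dot v v = 1 & dot u v = 0].

Definition orth V v := forall u, u \in V -> dot v u = 0.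

(* Projection onto the orthogonal complement of V. *)
Definition perp_proj V v : 'rV[R]_N :=
  xget 0 [set w | orth V w /\ v - w \in V].

Definition vspan (A : set 'rV[R]_N) : {vspace 'rV[R]_N} :=
  xget 0%VS [set V : {vspace 'rV[R]_N} | (forall v, A v -> v \in V) /\
    (forall W : {vspace 'rV[R]_N}, (forall v, A v -> v \in W) -> (V <= W)%VS)].

(* Possibly degenerate: r = 0 is allowed. *)
Definition is_circle (A : set 'rV[R]_N) :=
  exists (o e1 e2 : 'rV[R]_N) (r : R),
    [/\ 0 <= r, orthonormal_pair e1 e2 &
     A = [set o + r *: (cos psi *: e1 + sin psi *: e2) | psi in [set: R]]].

Definition euclidean_isometry (tau : 'rV[R]_N -> 'rV[R]_N) :=
  forall x y, enorm (tau x - tau y) = enorm (x - y).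

(* Matrices act on row vectors from the right. A parallel complex structure of
   a Euclidean space is, as usual for Riemannian metrics, orthogonal. *)
Definition parallel_complex_structure (I : 'M[R]_N) :=
  I *m I = - 1%:M /\ I *m I^T = 1%:M.

(* For orthonormal e1, e2 in the plane spanned by (a, b): they have the
   orientation of (a, b). *)
Definition same_orientation a b e1 e2 :=
  0 < dot a e1 * dot b e2 - dot a e2 * dot b e1.

(* A maps the plane V, oriented by (a, b), to itself by the rotation of angle
   theta; applying the condition to (e2, - e1) gives the image of e2. *)
Definition rotates V a b (theta : R) (A : 'M[R]_N) :=
  forall e1 e2, e1 \in V -> e2 \in V -> orthonormal_pair e1 e2 ->
    same_orientation a b e1 e2 ->
    e1 *m A = cos theta *: e1 + sin theta *: e2.

End Euclidean.

Section Smooth.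
Context {R : realType} {V W : normedModType R}.

Fixpoint Ck (k : nat) (U : set V) (f : V -> W) : Prop :=
  if k is k'.+1 then
    (forall x, U x -> differentiable f x) /\
    (forall v, Ck k' U (fun x => 'D_v f x))
  else forall x, U x -> {for x, continuous f}.

Definition smooth_on (U : set V) (f : V -> W) := forall k, Ck k U f.

Definition smooth_near (x : V) (f : V -> W) :=
  exists U : set V, [/\ open U, U x & smooth_on U f].

End Smooth.

(* Second fundamental form, normal connection, higher fundamental forms and
   higher normal spaces of a parametrized surface G defined near x. Vector
   fields are coordinate expressions X : 'rV_2 -> 'rV_2. *)
Section LocalForms.
Context {R : realType} {n : nat}.
Notation E := 'rV[R]_n.+2.
Notation field := ('rV[R]_2 -> 'rV[R]_2).
Variable G : 'rV[R]_2 -> E.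

Definition tangent_at (x : 'rV[R]_2) : {vspace E} :=
  vspan [set 'D_u G x | u in [set: 'rV[R]_2]].

Definition normal_proj (x : 'rV[R]_2) (v : E) : E := perp_proj (tangent_at x) v.

Definition second_form (X Y : field) (x : 'rV[R]_2) : E :=
  normal_proj x ('D_(X x) (fun y => 'D_(Y y) G y) x).

Definition nabla_perp (X : field) (xi : 'rV[R]_2 -> E) (x : 'rV[R]_2) : E :=
  normal_proj x ('D_(X x) xi x).

(* nabla_iter X j is nabla_(X (j+2)) ... nabla_(X 3) alpha(X 2, X 1). *)
Fixpoint nabla_iter (X : nat -> field) (j : nat) : 'rV[R]_2 -> E :=
  if j is j'.+1 then nabla_perp (X j'.+3) (nabla_iter X j')
  else second_form (X 2) (X 1).

(* nsum_at k x is N_1 + ... + N_k at x. *)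
Fixpoint nsum_at (k : nat) (x : 'rV[R]_2) : {vspace E} :=
  if k is k'.+1 then
    (nsum_at k' x +
     vspan [set perp_proj (nsum_at k' x) (nabla_iter X k' x) | X in
              [set X : nat -> field | forall i, smooth_near x (X i)]])%VS
  else 0%VS.

(* The form alpha^s, s >= 2, evaluated on X 1, ..., X s. Its value at x depends
   only on the values X i x. *)
Definition higher_form (s : nat) (X : nat -> field) (x : 'rV[R]_2) : E :=
  perp_proj (nsum_at (s - 2) x) (nabla_iter X (s - 2) x).

Definition nspace_at (k : nat) (x : 'rV[R]_2) : {vspace E} :=
  vspan [set higher_form k.+1 X x | X in
           [set X : nat -> field | forall i, smooth_near x (X i)]].

End LocalForms.

Record chart (R : realType) (L : topologicalType) := Chart {
  chart_dom : set L;
  chart_map : L -> 'rV[R]_2;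
  chart_inv : 'rV[R]_2 -> L;
  chart_dom_open : open chart_dom;
  chart_cod_open : open (chart_map @` chart_dom);
  chart_mapK : forall p, chart_dom p -> chart_inv (chart_map p) = p;
  chart_map_continuous :
    forall p, chart_dom p -> {for p, continuous chart_map};
  chart_inv_continuous :
    forall y, (chart_map @` chart_dom) y -> {for y, continuous chart_inv}
}.

Definition chart_cod (R : realType) (L : topologicalType) (c : chart R L) :
  set 'rV[R]_2 := chart_map c @` chart_dom c.

Definition transition (R : realType) (L : topologicalType) (c c' : chart R L) :
  'rV[R]_2 -> 'rV[R]_2 := chart_map c' \o chart_inv c.

Definition transition_dom (R : realType) (L : topologicalType)
    (c c' : chart R L) : set 'rV[R]_2 :=
  chart_cod c `&` chart_inv c @^-1` chart_dom c'.

(* The oriented atlas is indexed by the points of the surface, chart_at p being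
   a chart around p. The metric is given by its Gram matrices: gram p y is the
   matrix of the metric in the coordinate frame of chart_at p at the point with
   coordinates y. *)
Record oriented_riemannian_surface (R : realType) := OrientedRiemannianSurface {
  surface_sort :> topologicalType;
  surface_hausdorff : hausdorff_space surface_sort;
  surface_second_countable : @second_countable surface_sort;
  chart_at : surface_sort -> chart R surface_sort;
  chart_at_dom : forall p, chart_dom (chart_at p) p;
  transition_smooth : forall p q,
    smooth_on (transition_dom (chart_at p) (chart_at q))
              (transition (chart_at p) (chart_at q));
  transition_oriented : forall p q y,
    transition_dom (chart_at p) (chart_at q) y ->
    0 < \det ('J (transition (chart_at p) (chart_at q)) y);
  gram : surface_sort -> 'rV[R]_2 -> 'M[R]_2;
  gram_smooth : forall p, smooth_on (chart_cod (chart_at p)) (gram p);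
  gram_sym : forall p y, chart_cod (chart_at p) y -> (gram p y)^T = gram p y;
  gram_pos : forall p y (u : 'rV[R]_2), chart_cod (chart_at p) y -> u != 0 ->
    0 < (u *m gram p y *m u^T) 0 0;
  gram_transition : forall p q y,
    transition_dom (chart_at p) (chart_at q) y ->
    let t := transition (chart_at p) (chart_at q) in
    gram p y = 'J t y *m gram q (t y) *m ('J t y)^T
}.

Definition simply_connected (R : realType) (L : topologicalType) :=
  let I : set R := `[0%R, 1%R]%classic in
  (forall x y : L, exists c : R -> L,
     [/\ {within I, continuous c}, c 0 = x & c 1 = y]) /\
  (forall c : R -> L, {within I, continuous c} -> c 0 = c 1 ->
     exists H : R * R -> L,
       [/\ {within I `*` I, continuous H},
           forall t, I t -> H (0, t) = c t,
           forall t, I t -> H (1, t) = c 0 &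
           forall s, I s -> H (s, 0) = c 0 /\ H (s, 1) = c 0]).

Section Surfaces.
Context {R : realType} {L : oriented_riemannian_surface R}.
Implicit Types (p q : L) (y u w : 'rV[R]_2) (theta : R).

(* Tangent vectors at p are represented by their components in chart_at p. *)

Definition coord p : 'rV[R]_2 := chart_map (chart_at p) p.
Definition cod_at p : set 'rV[R]_2 := chart_cod (chart_at p).
Definition in_chart (T : Type) p (f : L -> T) : 'rV[R]_2 -> T :=
  f \o chart_inv (chart_at p).

Definition metric p y u w : R := (u *m gram p y *m w^T) 0 0.

(* The rotation by +90 degrees for the metric A = gram p y: with
   eps = [[0, 1], [-1, 0]] one has A *m eps *m A = \det A *: eps for
   symmetric A. *)
Definition cplxJ p y u : 'rV[R]_2 :=
  (Num.sqrt (\det (gram p y)))^-1 *: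
    (u *m gram p y *m (\matrix_(i < 2, j < 2) (j%:R - i%:R))).

Definition cplxJ_theta theta p y u : 'rV[R]_2 :=
  cos theta *: u + sin theta *: cplxJ p y u.

Definition smooth_map (W : normedModType R) (f : L -> W) :=
  forall p, smooth_on (cod_at p) (in_chart p f).

(* C^1 curves, taken on the whole line; only [0, 1] matters. *)
Definition C1_curve (c : R -> L) :=
  continuous c /\
  forall p t, chart_dom (chart_at p) (c t) ->
    derivable (chart_map (chart_at p) \o c) t 1 /\
    {for t, continuous (derive1 (chart_map (chart_at p) \o c))}.

Definition velocity (c : R -> L) (t : R) : 'rV[R]_2 :=
  derive1 (chart_map (chart_at (c t)) \o c) t.

Section Immersion.
Context {n : nat}.
Notation E := 'rV[R]_n.+2.
Variable g : L -> E.

Definition pushforward p u : E := 'D_u (in_chart p g) (coord p).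

Definition isometric_immersion :=
  smooth_map g /\
  forall p y u w, cod_at p y ->
    dot ('D_u (in_chart p g) y) ('D_w (in_chart p g) y) = metric p y u w.

Definition alpha p u w : E :=
  second_form (in_chart p g) (cst u) (cst w) (coord p).

Definition minimal :=
  forall p u w, metric p (coord p) u u = 1 -> metric p (coord p) w w = 1 ->
    metric p (coord p) u w = 0 -> alpha p u u + alpha p w w = 0.

Definition curvature_ellipse p u : set E :=
  [set let u_psi := cos psi *: u + sin psi *: cplxJ p (coord p) u in
       alpha p u_psi u_psi | psi in [set: R]].

Definition one_isotropic :=
  minimal /\
  forall p u, metric p (coord p) u u = 1 -> is_circle (curvature_ellipse p u).

Definition substantial :=
  forall U : set L, open U -> U !=set0 ->
    ~ exists (a : E) (V : {vspace E}),
        V != fullv /\ forall p, U p -> g p - a \in V.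

Definition holomorphic (I : 'M[R]_n.+2) :=
  forall p u, pushforward p (cplxJ p (coord p) u) = pushforward p u *m I.

(* g_theta is the associated surface x |-> int_(p0)^x g_* o J_theta, the
   integral being taken along any curve from p0 to x. *)
Definition associated (p0 : L) theta (g_theta : L -> E) :=
  forall c : R -> L, C1_curve c -> c 0 = p0 ->
    g_theta (c 1) = \row_(i < n.+2)
      Rintegral (@lebesgue_measure R) `[0%R, 1%R]%classic
        (fun t => pushforward (c t)
           (cplxJ_theta theta (c t) (coord (c t)) (velocity c t)) 0 i).

Definition tangent_space p : {vspace E} := tangent_at (in_chart p g) (coord p).

Definition normal_space (k : nat) p : {vspace E} :=
  nspace_at (in_chart p g) k (coord p).

Definition smooth_plane_field (B : L -> {vspace E}) :=
  forall p, \dim (B p) = 2 /\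
    exists (U : set 'rV[R]_2) (e1 e2 : 'rV[R]_2 -> E),
      [/\ open U /\ U (coord p), U `<=` cod_at p, smooth_on U e1, smooth_on U e2 &
       forall y, U y -> in_chart p B y = <<[:: e1 y; e2 y]>>%VS].

Definition smooth_extension_of_N1 (B : L -> {vspace E}) :=
  smooth_plane_field B /\
  forall p, (exists u w, alpha p u w != 0) -> B p = normal_space 1 p.

Variable N1bar : L -> {vspace E}.

Definition Lambda p : set E :=
  [set v | orth (tangent_space p) v /\ orth (N1bar p) v].

Definition total_space : set (L * E) := [set x | Lambda x.1 x.2].

Definition ruled_map (h : L -> E) (x : L * E) : E := h x.1 + x.2.

(* At these points the normal space is the orthogonal sum of N_1, ..., N_(n/2),
   all of them planes. *)
Definition generic p :=
  forall s, (1 <= s)%N -> (s.*2 <= n)%N -> \dim (normal_space s p) = 2.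

(* The field of endomorphisms R_theta of Lambda: only the restriction of
   A p to Lambda p matters. *)
Definition rotation_field theta (A : L -> 'M[R]_n.+2) :=
  [/\ forall p v, Lambda p v -> Lambda p (v *m A p),
      forall p (U : set 'rV[R]_2) (xi : 'rV[R]_2 -> E), open U ->
        U `<=` cod_at p -> smooth_on U xi ->
        (forall y, U y -> in_chart p Lambda y (xi y)) ->
        smooth_on U (fun y => xi y *m in_chart p A y) &
      forall p, generic p ->
        forall s, (2 <= s)%N -> (s.*2 <= n)%N ->
        forall X : 'rV[R]_2 -> 'rV[R]_2,
          smooth_near (coord p) X -> X (coord p) != 0 ->
          let G := in_chart p g in
          let JX := fun y => cplxJ p y (X y) in
          rotates (normal_space s p)
            (higher_form G s.+1 (fun=> X) (coord p))
            (higher_form G s.+1 (fun i => if i == 1%N then JX else X) (coord p))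
            theta (A p)].

Definition S_map (A : L -> 'M[R]_n.+2) (x : L * E) : L * E :=
  (x.1, x.2 *m A x.1).

End Immersion.
End Surfaces.

(* Main.v *)
(* Let I be the complex structure for which g is holomorphic and put
   T_theta = cos theta + sin theta I, an orthogonal matrix. Since
   g_theta_* = g_* o J_theta = g_* T_theta, integration along curves gives
   g_theta(p) = (g(p) - g(p0)) T_theta, and the isometry is
   tau(x) = (x - g(p0)) T_theta, provided that R_(- theta) is multiplication by
   T_(- theta) on Lambda_g.

   In a chart let xi_k be the (k+1)-st derivative of g in the first coordinate.
   The tangent space plus N_1, ..., N_k is the complex span of
   xi_0, ..., xi_k, and N_k is the complex line of the component eta_k of xi_k
   orthogonal to xi_0, ..., xi_(k-1). Moreover alpha^(k+1)(X, ..., X) = eta_k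
   and alpha^(k+1)(JX, X, ..., X) = eta_k I for the first coordinate field X, so
   that the rotation of an oriented plane N_k is multiplication by T. Hence R is
   T at the points where all the xi_k are linearly independent over the complex
   numbers.

   These points are dense: otherwise there are k and an open set where
   eta_0, ..., eta_(k-1) do not vanish but eta_k does; there the span of
   xi_0, ..., xi_(k-1) is closed under differentiation, hence constant, and the
   surface is not substantial. The equality R = T extends to all points by
   continuity, applied to smooth sections of Lambda_g. *)

Require Import Defs.
From HB Require Import structures.
From mathcomp Require Import all_boot all_order all_algebra.
From mathcomp Require Import all_classical all_reals all_analysis.
From mathcomp Require Import ring lra zify.

Set Implicit Arguments.
Unset Strict Implicit.
Unset Printing Implicit Defensive.

Import Order.TTheory GRing.Theory Num.Theory.
Import numFieldNormedType.Exports.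

Local Open Scope classical_set_scope.
Local Open Scope ring_scope.

(** * Linear algebra *)

(** The normal spaces are defined point by point, from arbitrary smooth fields, and their rank may
    drop, so there are no smooth bundles to start from. The proof therefore computes with modules of
    sections: [csection] keeps track of smooth complex coefficients, so that the order of a
    derivative and its remainder of lower order make sense even where the xi_k are dependent;
    pointwise spaces are recovered by evaluation. Division occurs in Gram-Schmidt, so the residuals
    eta_k are known to be smooth only where the earlier ones do not vanish; this is why independence
    is followed one order at a time. A second obstacle is that everything attached to a point is
    read in that point's own chart. Independence of the xi_k is carried between charts by the
    dimension of their complex span, because the xi_k themselves mix with lower orders. Finally, the
    associated surface is known only through C^1 curves, whereas simple connectedness supplies
    continuous paths. *)

Section Dot.
Context {R : realType} {N : nat}.
Implicit Types (u v w e : 'rV[R]_N) (V W : {vspace 'rV[R]_N}) (a : R).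

Lemma dotE u v : dot u v = \sum_i u 0 i * v 0 i.
Proof. by rewrite /dot mxE; apply: eq_bigr => i _; rewrite mxE. Qed.

Lemma dotC u v : dot u v = dot v u.
Proof. by rewrite !dotE; apply: eq_bigr => i _; rewrite mulrC. Qed.

Lemma dotDl u v w : dot (u + v) w = dot u w + dot v w.
Proof. by rewrite /dot mulmxDl mxE. Qed.

Lemma dotZl a u w : dot (a *: u) w = a * dot u w.
Proof. by rewrite /dot -scalemxAl mxE. Qed.

Lemma dotDr u v w : dot w (u + v) = dot w u + dot w v.
Proof. by rewrite dotC dotDl !(dotC w). Qed.

Lemma dotZr a u w : dot w (a *: u) = a * dot w u.
Proof. by rewrite dotC dotZl (dotC w). Qed.

Lemma dotNl u w : dot (- u) w = - dot u w.
Proof. by rewrite -scaleN1r dotZl mulN1r. Qed.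

Lemma dotNr u w : dot w (- u) = - dot w u.
Proof. by rewrite dotC dotNl dotC. Qed.

Lemma dotBl u v w : dot (u - v) w = dot u w - dot v w.
Proof. by rewrite dotDl dotNl. Qed.

Lemma dotBr u v w : dot w (u - v) = dot w u - dot w v.
Proof. by rewrite dotDr dotNr. Qed.

Lemma dot0l w : dot 0 w = 0.
Proof. by rewrite -(scale0r 0) dotZl mul0r. Qed.

Lemma dot0r w : dot w 0 = 0.
Proof. by rewrite dotC dot0l. Qed.

Lemma dot_ge0 u : 0 <= dot u u.
Proof. by rewrite dotE sumr_ge0 // => i _; rewrite -expr2 sqr_ge0. Qed.

Lemma dot_eq0 u : (dot u u == 0) = (u == 0).
Proof.
apply/idP/eqP => [|->]; last by rewrite dot0l.
rewrite dotE psumr_eq0 => [/allP h|i _]; last by rewrite -expr2 sqr_ge0.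
apply/rowP => i; rewrite mxE.
by have /(_ (mem_index_enum i))/implyP/(_ isT) := h i; rewrite mulf_eq0 orbb => /eqP.
Qed.

Lemma dot_gt0 u : (0 < dot u u) = (u != 0).
Proof. by rewrite lt0r dot_ge0 andbT dot_eq0. Qed.

Definition dot_lin := (dotDl, dotDr, dotBl, dotBr, dotZl, dotZr, dotNl, dotNr).

Lemma orthB V u v : orth V u -> orth V v -> orth V (u - v).
Proof. by move=> hu hv w wV; rewrite dotBl hu // hv // subrr. Qed.

Lemma orthD V u v : orth V u -> orth V v -> orth V (u + v).
Proof. by move=> hu hv w wV; rewrite dotDl hu // hv // addr0. Qed.

Lemma orthZ V a u : orth V u -> orth V (a *: u).
Proof. by move=> hu w wV; rewrite dotZl hu // mulr0. Qed.

Lemma orthS V W u : (V <= W)%VS -> orth W u -> orth V u.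
Proof. by move=> /subvP VW h v /VW/h. Qed.

Lemma orth_addv V W u : orth V u -> orth W u -> orth (V + W)%VS u.
Proof.
by move=> hV hW v /memv_addP[v1 v1V [v2 v2W ->]]; rewrite dotDr hV // hW // addr0.
Qed.

Lemma orth_line e u : dot u e = 0 -> orth <[e]>%VS u.
Proof. by move=> h v /vlineP[k ->]; rewrite dotZr h mulr0. Qed.

Lemma orth_mem0 V u : u \in V -> orth V u -> u = 0.
Proof. by move=> uV /(_ u uV)/eqP; rewrite dot_eq0 => /eqP. Qed.

Lemma memv_addl V W u : u \in V -> u \in (V + W)%VS.
Proof. exact/subvP/addvSl. Qed.

Lemma memv_addr V W u : u \in W -> u \in (V + W)%VS.
Proof. exact/subvP/addvSr. Qed.

(* Gram-Schmidt; a zero residual is harmless since division by 0 gives 0. *)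
Lemma perp_exists V v : exists w, orth V w /\ v - w \in V.
Proof.
have [s <-] : exists s : seq 'rV[R]_N, << s >>%VS = V.
  by exists (vbasis V); rewrite (span_basis (vbasisP V)).
elim: s v => [|b s IH] v.
  exists v; rewrite subrr mem0v span_nil; split=> // u.
  by rewrite memv0 => /eqP->; rewrite dot0r.
have [e [eo es]] := IH b; have [r [ro rs]] := IH v.
exists (r - (dot r e / dot e e) *: e); split.
  rewrite span_cons; apply: orth_addv; last exact/orthB/orthZ.
  apply: orth_line; have -> : b = e + (b - e) by rewrite addrC subrK.
  rewrite dotDr (orthB ro (orthZ _ eo) es) addr0 !dot_lin.
  have [->|e0] := eqVneq e 0; first by rewrite !dot0r mulr0 subr0.
  by rewrite divfK ?subrr // dot_eq0.
rewrite opprB addrCA span_cons memvD //; last exact: memv_addr.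
apply: memvZ; have -> : e = b - (b - e) by rewrite subKr.
by apply: memvB; [apply: memv_addl; exact: memv_line | exact: memv_addr].
Qed.

Lemma perp_projP V v : orth V (perp_proj V v) /\ v - perp_proj V v \in V.
Proof.
have [w hw] := perp_exists V v.
exact: (@xgetPex _ 0 [set w | orth V w /\ v - w \in V] (ex_intro _ w hw)).
Qed.

Lemma perp_proj_orth V v : orth V (perp_proj V v).
Proof. by have [] := perp_projP V v. Qed.

Lemma perp_proj_mem V v : v - perp_proj V v \in V.
Proof. by have [] := perp_projP V v. Qed.

(** Two candidates differ by a vector that lies in V and is orthogonal to V. As [perp_proj] is a
    choice, this uniqueness is how its values are computed. *)
Lemma perp_projE V v w : orth V w -> v - w \in V -> perp_proj V v = w.
Proof.
move=> ow vw; apply/eqP; rewrite -subr_eq0; apply/eqP.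
apply: (@orth_mem0 V); last exact/orthB/ow/perp_proj_orth.
have -> : perp_proj V v - w = (v - w) - (v - perp_proj V v).
  by rewrite opprB [RHS]addrC addrA subrK.
by rewrite memvB // perp_proj_mem.
Qed.

Lemma perp_projD V v w : perp_proj V (v + w) = perp_proj V v + perp_proj V w.
Proof.
apply: perp_projE; first exact/orthD/perp_proj_orth/perp_proj_orth.
by rewrite opprD addrACA memvD // perp_proj_mem.
Qed.

Lemma perp_projZ V a v : perp_proj V (a *: v) = a *: perp_proj V v.
Proof.
apply: perp_projE; first exact/orthZ/perp_proj_orth.
by rewrite -scalerBr memvZ // perp_proj_mem.
Qed.

Lemma perp_projB V v w : perp_proj V (v - w) = perp_proj V v - perp_proj V w.
Proof. by rewrite -scaleN1r perp_projD perp_projZ scaleN1r. Qed.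

Lemma perp_proj_id V v : orth V v -> perp_proj V v = v.
Proof. by move=> h; apply: perp_projE => //; rewrite subrr mem0v. Qed.

Lemma perp_proj0 V v : v \in V -> perp_proj V v = 0.
Proof. by move=> h; apply: perp_projE; [move=> u _; rewrite dot0l | rewrite subr0]. Qed.

Lemma perp_proj_eq0 V v : (perp_proj V v == 0) = (v \in V).
Proof.
apply/eqP/idP => [h|]; last exact: perp_proj0.
by have := perp_proj_mem V v; rewrite h subr0.
Qed.

Lemma perp_proj_eqmod V v w : v - w \in V -> perp_proj V v = perp_proj V w.
Proof.
by move=> h; apply/eqP; rewrite -subr_eq0 -perp_projB perp_proj_eq0.
Qed.

(** Higher forms are projected away from N_1 + ... + N_k only. For normal vectors this agrees with
    projecting away from the tangent plane as well, so the full osculating space may be used. *)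
Lemma perp_proj_addv (T S : {vspace 'rV[R]_N}) v : orth T v -> (forall s, s \in S -> orth T s) ->
  perp_proj (T + S)%VS v = perp_proj S v.
Proof.
move=> Tv TS; apply/esym/perp_projE.
  exact/(orthS (addvSr T S))/perp_proj_orth.
have /memv_addP[t tT [s sS e]] := perp_proj_mem (T + S)%VS v.
have t0 : t = 0.
  apply: (orth_mem0 tT); have -> : t = v - perp_proj (T + S)%VS v - s.
    by rewrite e addrK.
  apply: orthB; last exact: TS.
  by apply: orthB => //; apply: (orthS (addvSl T S)); exact: perp_proj_orth.
by rewrite e t0 add0r.
Qed.

Lemma vspan_eq (A : set 'rV[R]_N) W : (forall v, A v -> v \in W) ->
  (forall V, (forall v, A v -> v \in V) -> (W <= V)%VS) -> vspan A = W.
Proof.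
move=> AW Wmin.
have [AV Vmin] : (forall v, A v -> v \in vspan A) /\
    (forall V, (forall v, A v -> v \in V) -> (vspan A <= V)%VS).
  exact: (@xgetPex _ 0%VS [set V : {vspace 'rV[R]_N} | (forall v, A v -> v \in V) /\
    (forall W : {vspace 'rV[R]_N}, (forall v, A v -> v \in W) -> (V <= W)%VS)]
    (ex_intro _ W (conj AW Wmin))).
by apply/eqP; rewrite eqEsubv Vmin // Wmin.
Qed.
End Dot.

(** * Orthogonal complex structures and complex lines *)

Section ComplexStructure.
Context {R : realType} {N : nat} (I : 'M[R]_N).
Hypothesis I_cs : parallel_complex_structure I.
Implicit Types (u v w e : 'rV[R]_N) (V W : {vspace 'rV[R]_N}) (a : R).

Lemma mulII u : u *m I *m I = - u.
Proof. by case: I_cs => h _; rewrite -mulmxA h mulmxN mulmx1. Qed.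

Lemma dotII u v : dot (u *m I) (v *m I) = dot u v.
Proof.
by case: I_cs => _ h; rewrite /dot trmx_mul mulmxA -(mulmxA u) h mulmx1.
Qed.

Lemma dotIr u v : dot u (v *m I) = - dot (u *m I) v.
Proof. by rewrite -[in RHS]dotII mulII dotNl opprK. Qed.

Lemma dotI0 u : dot u (u *m I) = 0.
Proof. have := dotIr u u; rewrite [in RHS]dotC; lra. Qed.

Definition cspan u : {vspace 'rV[R]_N} := (<[u]> + <[u *m I]>)%VS.

Lemma cspanP u v :
  reflect (exists a b, v = a *: u + b *: (u *m I)) (v \in cspan u).
Proof.
apply: (iffP idP) => [/memv_addP[_ /vlineP[a ->] [_ /vlineP[b ->] ->]]|].
  by exists a, b.
by move=> [a [b ->]]; rewrite memv_add // memvZ // memv_line.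
Qed.

Definition Istable V := forall v, v \in V -> v *m I \in V.

Lemma cspan_stable u : Istable (cspan u).
Proof.
move=> v /cspanP[a [b ->]]; apply/cspanP; exists (- b), a.
by rewrite mulmxDl -!scalemxAl mulII scalerN scaleNr addrC.
Qed.

Lemma addv_stable V W : Istable V -> Istable W -> Istable (V + W)%VS.
Proof.
move=> sV sW v /memv_addP[a aV [b bW ->]].
by rewrite mulmxDl memv_add ?sV ?sW.
Qed.

Lemma cspan_sub u V : Istable V -> u \in V -> (cspan u <= V)%VS.
Proof.
by move=> sV uV; apply/subvP => v /cspanP[a [b ->]]; rewrite memvD // memvZ ?sV.
Qed.

Lemma mem_cspan u : u \in cspan u.
Proof. by rewrite memv_addl // memv_line. Qed.

Lemma dim_cspan u : u != 0 -> \dim (cspan u) = 2.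
Proof.
move=> u0; have uI0 : u *m I != 0 by rewrite -dot_eq0 dotII dot_eq0.
rewrite dimv_disjoint_sum ?dim_vline ?u0 ?uI0 //.
apply/eqP; rewrite -subv0; apply/subvP => v; rewrite memv_cap.
move=> /andP[/vlineP[a ->] /vlineP[b e]].
have : dot (a *: u) (a *: u) = 0 by rewrite {2}e !dot_lin dotI0 !mulr0.
by move/eqP; rewrite dot_eq0 => /eqP->; rewrite mem0v.
Qed.

Lemma orthI V u : Istable V -> orth V u -> orth V (u *m I).
Proof.
by move=> sV h v vV; apply: oppr_inj; rewrite -dotIr h ?oppr0 // sV.
Qed.

Lemma perp_projI V u : Istable V -> perp_proj V (u *m I) = perp_proj V u *m I.
Proof.
move=> sV; apply: perp_projE; first exact/orthI/perp_proj_orth.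
by rewrite -mulmxBl sV // perp_proj_mem.
Qed.

Lemma orth_cspan e u : orth (cspan e) u <-> dot u e = 0 /\ dot u (e *m I) = 0.
Proof.
split=> [h|[h1 h2]]; first by rewrite !h ?cspan_stable ?mem_cspan.
by apply: orth_addv; exact: orth_line.
Qed.

(* This is 0 for [e = 0], as division by 0 gives 0. *)
Definition cproj e u : 'rV[R]_N :=
  (dot u e / dot e e) *: e + (dot u (e *m I) / dot e e) *: (e *m I).

Lemma cproj_perp e u : perp_proj (cspan e) u = u - cproj e u.
Proof.
apply: perp_projE; last by rewrite subKr; apply/cspanP; eexists _, _.
have [->|e0] := eqVneq e 0.
  by apply/orth_cspan; rewrite mul0mx !dot0r.
have ee : dot e e != 0 by rewrite dot_eq0.
apply/orth_cspan; rewrite /cproj !dot_lin dotII dotI0 dotC (dotC _ e) dotI0 !mulr0.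
by rewrite addr0 add0r !divfK // ![dot u _]dotC !subrr.
Qed.

(** * Complex Gram-Schmidt along a sequence of vectors *)

Section Flag.
Variable z : nat -> 'rV[R]_N.

Fixpoint complex_flag k : {vspace 'rV[R]_N} :=
  if k is k'.+1 then (complex_flag k' + cspan (z k'))%VS else 0%VS.

Definition flag_perp k := perp_proj (complex_flag k) (z k).

Lemma complex_flag_stable k : Istable (complex_flag k).
Proof.
elim: k => [v|k IH]; last exact/addv_stable/cspan_stable.
by rewrite memv0 => /eqP->; rewrite mul0mx mem0v.
Qed.

Lemma complex_flag_mem i k : (i < k)%N -> z i \in complex_flag k.
Proof.
elim: k => // k IH; rewrite ltnS leq_eqVlt => /predU1P[->|/IH h].
  by rewrite memv_addr // mem_cspan.
by rewrite memv_addl.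
Qed.

Lemma complex_flag_leS k : (complex_flag k <= complex_flag k.+1)%VS.
Proof. exact: addvSl. Qed.

Lemma complex_flag_le i k : (i <= k)%N -> (complex_flag i <= complex_flag k)%VS.
Proof.
move=> /subnKC <-; elim: (k - i)%N => [|m IH]; first by rewrite addn0.
by rewrite addnS (subv_trans IH) // complex_flag_leS.
Qed.

Lemma complex_flag_sub k V : Istable V -> (forall i, (i < k)%N -> z i \in V) ->
  (complex_flag k <= V)%VS.
Proof.
move=> sV; elim: k => [|k IH] h; first exact: sub0v.
by rewrite subv_add IH ?cspan_sub ?h // => i ik; rewrite h // ltnW.
Qed.

Lemma complex_flagS_perp k : complex_flag k.+1 = (complex_flag k + cspan (flag_perp k))%VS.
Proof.
have h := perp_proj_mem (complex_flag k) (z k).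
have sk : Istable (complex_flag k) by exact: complex_flag_stable.
have st u : Istable (complex_flag k + cspan u)%VS.
  by apply: addv_stable => //; exact: cspan_stable.
apply/eqP; rewrite eqEsubv /=; apply/andP; split.
  rewrite (subv_add (complex_flag k)) addvSl /=; apply: cspan_sub => //.
  rewrite -(subrK (flag_perp k) (z k)) memvD //; first by rewrite memv_addl.
  by rewrite memv_addr // mem_cspan.
rewrite (subv_add (complex_flag k)) addvSl /=; apply: cspan_sub => //.
rewrite /flag_perp -(subrK (z k) (perp_proj _ _)) memvD //.
  by rewrite memv_addl // -memvN opprB.
by rewrite memv_addr // mem_cspan.
Qed.

Lemma flag_perp_orth k : orth (complex_flag k) (flag_perp k).
Proof. exact: perp_proj_orth. Qed.

Lemma dim_complex_flagS k : \dim (complex_flag k.+1) = (\dim (complex_flag k) + (flag_perp k != 0%R).*2)%N.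
Proof.
rewrite complex_flagS_perp; case: eqVneq => [->|e0].
  by rewrite /cspan mul0mx !addv0 addn0.
rewrite dimv_disjoint_sum ?dim_cspan //.
apply/eqP; rewrite -subv0; apply/subvP => v; rewrite memv_cap => /andP[vk ve].
rewrite memv0; apply/eqP/(orth_mem0 vk) => w wk.
case/cspanP: ve => a [b ->]; rewrite !dot_lin flag_perp_orth //.
by rewrite -[dot _ w]opprK -dotIr flag_perp_orth ?complex_flag_stable // oppr0 !mulr0 addr0.
Qed.

Lemma dim_complex_flag k : (\dim (complex_flag k) <= k.*2)%N.
Proof.
elim: k => [|k IH]; first by rewrite dimv0.
by rewrite dim_complex_flagS doubleS; case: (_ != _); rewrite ?addn2 ?addn0 // ltnW // ltnW.
Qed.

(** Expresses independence through the span alone, which is what a change of chart can be compared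
    on. *)
Lemma dim_complex_flag_full k :
  \dim (complex_flag k) = k.*2 <-> (forall j, (j < k)%N -> flag_perp j != 0).
Proof.
elim: k => [|k IH]; first by rewrite dimv0.
rewrite dim_complex_flagS; split=> [h j|h].
  have e0 : flag_perp k != 0.
    move: h; case: (_ != _) => //; rewrite addn0 => h.
    by have := dim_complex_flag k; rewrite h doubleS ltnNge leqnSn.
  have /IH h1 : \dim (complex_flag k) = k.*2 by move: h; rewrite e0 doubleS /= => h; lia.
  by rewrite ltnS leq_eqVlt => /predU1P[->//|/h1].
by rewrite h // (IH.2 _) ?doubleS ?addn2 // => j jk; rewrite h // ltnW.
Qed.

(** One Gram-Schmidt step as a rational formula, from which smoothness of the residuals is read
    off. *)
Lemma perp_complex_flagS k u : let r := perp_proj (complex_flag k) u in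
  perp_proj (complex_flag k.+1) u = r - cproj (flag_perp k) r.
Proof.
move=> r; have ro := @perp_proj_orth _ _ (complex_flag k) u.
rewrite -cproj_perp complex_flagS_perp -(@perp_proj_addv R N (complex_flag k) _ r) //=.
  by apply: perp_proj_eqmod; rewrite memv_addl // perp_proj_mem.
move=> s /cspanP[a [b ->]]; apply: orthD; apply: orthZ; first exact: flag_perp_orth.
exact/orthI/flag_perp_orth/complex_flag_stable.
Qed.

End Flag.
End ComplexStructure.

(** * Smooth maps *)

Lemma continuous_near_eq (T U : topologicalType) (f g : T -> U) x : (\forall y \near x, f y = g y) ->
  {for x, continuous f} -> {for x, continuous g}.
Proof.
move=> fg cf; have fgx : f x = g x := nbhs_singleton fg.
suff : g @ x --> g x by [].
by rewrite -fgx; apply: cvg_trans cf; exact: near_eq_cvg.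
Qed.

Section CkGeneral.
Context {R : realType} {V W : normedModType R}.
Implicit Types (f g : V -> W) (U : set V).

Lemma near_open U (P : set V) x : open U -> U x -> (forall y, U y -> P y) ->
  \forall y \near x, P y.
Proof. by move=> oU Ux UP; apply: filterS (open_nbhs_nbhs (conj oU Ux)). Qed.

Lemma derive_open_ext U f g x v : open U -> U x -> (forall y, U y -> f y = g y) ->
  'D_v f x = 'D_v g x.
Proof. by move=> oU Ux fg; apply/near_eq_derive/(near_open oU Ux). Qed.

(** The differential of [f] serves for [g]: the little-o estimate concerns only a neighbourhood. *)
Lemma differentiable_near_eq f g x : (\forall y \near x, f y = g y) ->
  differentiable f x -> differentiable g x.
Proof.
move=> fg df; apply/diffP => /=.
apply: (@getPex _ (fun (dg : {linear V -> W}) => continuous dg /\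
  forall y, g y = g (lim (nbhs x)) + dg (y - lim (nbhs x))
                  +o_(y \near x) (y - lim (nbhs x)))).
exists ('d f x); split; first exact: diff_continuous.
have /diffP[_ fE] := df; rewrite lim_id // in fE *.
have {fE} /eqaddoP fo : f = (fun y => f x + 'd f x (y - x)) +o_x (center x).
  exact/funext.
suff /eqaddoP/funeqP : forall e : R, 0 < e -> \forall y \near x,
  `|(g - (fun y => g x + 'd f x (y - x))) y| <= e * `|center x y| by [].
move=> e e0; have gx : f x = g x := nbhs_singleton fg.
near=> y; rewrite -gx /= -[(g - _) y]/(g y - (f x + 'd f x (y - x))).
have <- : f y = g y by near: y.
by near: y; apply: fo.
Unshelve. all: by end_near. Qed.

Lemma Ck_ext k U f g : open U -> (forall y, U y -> f y = g y) -> Ck k U f -> Ck k U g.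
Proof.
move=> oU; elim: k f g => [|k IH] f g fg /=.
  move=> cf x Ux; apply: continuous_near_eq (cf x Ux); exact: near_open oU Ux _.
move=> [df Df]; split=> [x Ux|v].
  by apply: differentiable_near_eq (df x Ux); exact: near_open oU Ux _.
apply: IH (Df v) => y Uy; exact: derive_open_ext oU Uy fg.
Qed.

Lemma Ck_sub k U U' f : U' `<=` U -> Ck k U f -> Ck k U' f.
Proof.
move=> UU; elim: k f => [|k IH] f /=; first by move=> cf x /UU/cf.
by move=> [df Df]; split=> [x /UU/df//|v]; apply: IH.
Qed.

Lemma CkW k U f : Ck k.+1 U f -> Ck k U f.
Proof.
elim: k f => [|k IH] f [df Df]; last by split=> // v; apply: IH.
by move=> x /df/differentiable_continuous.
Qed.

Lemma Ck_cst k U (w : W) : Ck k U (fun=> w).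
Proof.
elim: k w => [|k IH] w /=; first by move=> x _; exact: cvg_cst.
split=> [x _|v]; first exact: differentiable_cst.
by rewrite (_ : 'D_v _ = fun=> 0) //; apply/funext => x; exact: derive_cst.
Qed.

Lemma Ck_add k U f g : open U -> Ck k U f -> Ck k U g -> Ck k U (fun x => f x + g x).
Proof.
move=> oU; elim: k f g => [|k IH] f g /=.
  by move=> cf cg x Ux; apply: cvgD; [exact: cf | exact: cg].
move=> [df Df] [dg Dg]; split=> [x Ux|v].
  by apply: differentiableD; [exact: df | exact: dg].
apply: Ck_ext (IH _ _ (Df v) (Dg v)) => // y Uy.
by rewrite (@deriveD _ _ _ f g) //; apply: diff_derivable; [exact: df | exact: dg].
Qed.

End CkGeneral.

Section CkScalar.
Context {R : realType} {V : normedModType R}.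
Implicit Types (f g : V -> R) (U : set V).

Lemma Ck_mul k U f g : open U -> Ck k U f -> Ck k U g -> Ck k U (fun x => f x * g x).
Proof.
move=> oU; elim: k f g => [|k IH] f g.
  by move=> cf cg x Ux; apply: cvgM; [exact: cf | exact: cg].
move=> Cf Cg; have [df Df] := Cf; have [dg Dg] := Cg; split=> [x Ux|v].
  by apply: differentiableM; [exact: df | exact: dg].
apply: (@Ck_ext _ _ _ _ _ (fun y => f y * 'D_v g y + g y * 'D_v f y)) => // [y Uy|].
  by apply/esym/(@deriveM _ _ f g); apply: diff_derivable; [exact: df | exact: dg].
by apply: Ck_add => //; apply: IH; [exact: CkW | exact: Dg | exact: CkW | exact: Df].
Qed.

Lemma Ck_inv k U f : open U -> (forall x, U x -> f x != 0) -> Ck k U f ->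
  Ck k U (fun x => (f x)^-1).
Proof.
move=> oU f0; elim: k => [|k IH].
  by move=> cf x Ux; exact: cvgV (f0 x Ux) (cf x Ux).
move=> Cf; have [df Df] := Cf; split=> [x Ux|v].
  by apply: differentiableV; [exact: df | exact: f0].
have IH' := IH (CkW Cf).
apply: (@Ck_ext _ _ _ _ _ (fun y => (-1) * ((f y)^-1 * (f y)^-1 * 'D_v f y))) => // [y Uy|].
  rewrite (@deriveV _ _ f) ?f0 //; last exact/diff_derivable/df.
  by rewrite /GRing.scale /= expr2 invfM mulN1r mulNr.
apply: Ck_mul => //; first exact: Ck_cst.
by apply: Ck_mul => //; [exact: Ck_mul | exact: Df].
Qed.

End CkScalar.

Section CkRow.
Context {R : realType} {V : normedModType R} {N : nat}.
Implicit Types (f g : V -> 'rV[R]_N) (U : set V).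

Lemma differentiable_row f x :
  differentiable f x <-> forall j, differentiable (fun y => f y 0 j) x.
Proof.
split=> [df j|df].
  apply: (@differentiable_comp _ _ _ _ f (fun v : 'rV[R]_N => v 0 j)) => //.
  exact: differentiable_coord.
have -> : f = fun y => \sum_j f y 0 j *: delta_mx 0 j.
  by apply/funext => y; exact: row_sum_delta.
have -> : (fun y => \sum_j f y 0 j *: delta_mx 0 j) =
   \sum_j (fun y => f y 0 j *: (delta_mx 0 j : 'rV[R]_N)).
  by apply/funext => y; rewrite fct_sumE.
apply: differentiable_sum => j; exact: differentiableZl.
Qed.

Lemma continuous_row f x :
  {for x, continuous f} <-> forall j, {for x, continuous (fun y => f y 0 j)}.
Proof.
split=> [cf j|cf].
  apply: (@continuous_comp _ _ _ f (fun v : 'rV[R]_N => v 0 j)) => //.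
  exact: coord_continuous.
have -> : f = fun y => \sum_j f y 0 j *: delta_mx 0 j.
  by apply/funext => y; exact: row_sum_delta.
have -> : (fun y => \sum_j f y 0 j *: delta_mx 0 j) =
   \sum_j (fun y => f y 0 j *: (delta_mx 0 j : 'rV[R]_N)).
  by apply/funext => y; rewrite fct_sumE.
apply: (@big_ind _ (fun h : V -> 'rV[R]_N => {for x, continuous h})).
- exact: cvg_cst.
- by move=> h1 h2 c1 c2; exact: cvgD c1 c2.
- by move=> j _; apply: cvgZr_tmp; exact: cf.
Qed.

Lemma derive_row f x v j : differentiable f x ->
  ('D_v f x) 0 j = 'D_v (fun y => f y 0 j) x.
Proof. by move=> df; rewrite derive_mx ?mxE //; exact: diff_derivable. Qed.

Lemma Ck_row k U f : open U ->
  Ck k U f <-> forall j, Ck k U (fun y => f y 0 j).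
Proof.
move=> oU; elim: k f => [|k IH] f /=.
  split=> [cf j x Ux|cf x Ux]; first exact: (continuous_row f x).1 (cf x Ux) j.
  by apply/continuous_row => j; apply: cf.
split=> [[df Df] j|Cf].
  split=> [x Ux|v]; first exact: (differentiable_row f x).1 (df x Ux) j.
  have /IH/(_ j) := Df v; apply: Ck_ext => // y Uy; rewrite derive_row //; exact: df.
have df x : U x -> differentiable f x.
  by move=> Ux; apply/differentiable_row => j; have [df _] := Cf j; exact: df.
split=> // v; apply/IH => j; have [_ /(_ v)] := Cf j.
by apply: Ck_ext => // y Uy; rewrite derive_row //; exact: df.
Qed.
End CkRow.

(** * Restriction to lines and symmetry of second derivatives *)

Section LineDerivative.
Context {R : realType} {V W : normedModType R}.

Lemma is_derive_line (f : V -> W) (x u : V) (s : R) :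
  derivable f (x + s *: u) u ->
  is_derive s (1 : R) (fun t : R => f (x + t *: u)) ('D_u f (x + s *: u)).
Proof.
move=> df.
have e : (fun h : R => h^-1 *: (((fun t : R => f (x + t *: u)) \o shift s) (h *: (1 : R)) - f (x + s *: u))) =
   (fun h : R => h^-1 *: ((f \o shift (x + s *: u)) (h *: u) - f (x + s *: u))).
  apply/funext => h /=; congr (_ *: (f _ - _)).
  have -> : h *: (1 : R) = h by exact: mulr1.
  by rewrite scalerDl addrCA.
by split; rewrite /derivable /derive e.
Qed.

Lemma nbhs_quadrant (x u v : V) (P : set V) : nbhs x P ->
  exists2 h : R, 0 < h & forall s t : R, 0 <= s <= h -> 0 <= t <= h ->
    P (x + s *: u + t *: v).
Proof.
(* The summand 1 keeps M positive when u = v = 0. *)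
move=> /nbhs_ballP[d /= d0 dP]; pose M := `|u| + `|v| + 1.
have M0 : 0 < M by rewrite ltr_wpDl // addr_ge0.
exists (d / M / 2) => [|s t /andP[s0 sh] /andP[t0 th]]; first by rewrite !divr_gt0.
apply: dP; rewrite -ball_normE /= -addrA opprD addrA subrr add0r normrN.
rewrite (le_lt_trans (ler_normD _ _)) // !normrZ !ger0_norm //.
have -> : d = d / M * M by rewrite divfK // gt_eqF.
have h0 : 0 < d / M by rewrite divr_gt0.
apply: (@le_lt_trans _ _ (d / M / 2 * (`|u| + `|v|))).
  by rewrite mulrDr lerD // ler_wpM2r.
have : 0 <= `|u| + `|v| by rewrite addr_ge0.
rewrite /M; move: (`|u| + `|v|) (d / M) h0 => w e e0 w0; have := mulr_ge0 (ltW e0) w0; nra.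
Qed.
End LineDerivative.

Section Schwarz.
Context {R : realType} {V : normedModType R}.

(* Two applications of the mean value theorem to the second difference. *)
Lemma second_difference (f : V -> R) (x u v : V) (h : R) : 0 < h ->
  (forall s t : R, 0 <= s <= h -> 0 <= t <= h ->
    derivable f (x + s *: u + t *: v) u /\
    derivable ('D_u f) (x + s *: u + t *: v) v) ->
  exists s t : R, [/\ 0 <= s <= h, 0 <= t <= h &
    f (x + h *: u + h *: v) - f (x + h *: u) - f (x + h *: v) + f x =
    h * h * 'D_v ('D_u f) (x + s *: u + t *: v)].
Proof.
move=> h0 df.
have hh : 0 <= h <= h by rewrite lexx ltW.
have h00 : 0 <= (0 : R) <= h by rewrite lexx ltW.
pose a (s : R) := f (x + h *: v + s *: u) - f (x + s *: u).
have da s : 0 <= s <= h -> is_derive s (1 : R) a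
    ('D_u f (x + h *: v + s *: u) - 'D_u f (x + s *: u)).
  move=> hs; apply: is_deriveB; apply: is_derive_line.
    by have [] := df s h hs hh; rewrite addrAC.
  by have [] := df s 0 hs h00; rewrite scale0r addr0.
have [||s shE sE] := @MVT_segment R a
   (fun s => 'D_u f (x + h *: v + s *: u) - 'D_u f (x + s *: u)) 0 h (ltW h0).
  by move=> s; rewrite in_itv /= => /andP[s0 sh]; apply: da; rewrite !ltW.
  apply: derivable_within_continuous => s; rewrite in_itv /= => hs.
  by have [] := da s hs.
have {}sh : 0 <= s <= h by move: shE; rewrite in_itv.
pose b (t : R) := 'D_u f (x + s *: u + t *: v).
have db t : 0 <= t <= h -> is_derive t (1 : R) b ('D_v ('D_u f) (x + s *: u + t *: v)).
  by move=> ht; apply: is_derive_line; have [] := df s t sh ht.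
have [||t thE tE] := @MVT_segment R b
   (fun t => 'D_v ('D_u f) (x + s *: u + t *: v)) 0 h (ltW h0).
  by move=> t; rewrite in_itv /= => /andP[t0 th]; apply: db; rewrite !ltW.
  apply: derivable_within_continuous => t; rewrite in_itv /= => ht.
  by have [] := db t ht.
have {}th : 0 <= t <= h by move: thE; rewrite in_itv.
exists s, t; split=> //.
move: sE tE; rewrite /a /b !scale0r !addr0 subr0 (addrAC x (h *: v)).
rewrite (addrAC x (h *: v)) => sE tE; rewrite tE in sE.
move: sE; move: ('D_v _ _) (f (x + h *: u + h *: v)) (f (x + h *: u)) => D A B.
move: (f (x + h *: v)) (f x) => C E; lra.
Qed.

(** The second difference is symmetric in u and v, so the two mixed derivatives agree when taken at
    suitable points of an arbitrarily small parallelogram at x; continuity brings both points back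
    to x. *)
Lemma schwarz (f : V -> R) U x u v : open U -> smooth_on U f -> U x ->
  'D_v ('D_u f) x = 'D_u ('D_v f) x.
Proof.
(* Order 3 makes the mixed second derivatives differentiable, hence continuous. *)
move=> oU sf Ux; have [_ /(_ u) C1u] := sf 3; have [_ /(_ v) C1v] := sf 3.
have [df _] := sf 1; have [du /(_ v) [duv _]] := C1u; have [dv /(_ u) [dvu _]] := C1v.
apply/eqP; rewrite -subr_eq0 -normr_le0; apply/ler_addgt0Pl => e e0; rewrite addr0.
have e2 : 0 < e / 2 by rewrite divr_gt0.
have c1 : 'D_v ('D_u f) @ x --> 'D_v ('D_u f) x.
  exact: (differentiable_continuous (duv x Ux)).
have c2 : 'D_u ('D_v f) @ x --> 'D_u ('D_v f) x.
  exact: (differentiable_continuous (dvu x Ux)).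
have /nbhs_quadrant-/(_ u v)[h h0 hP] : \forall y \near x, [/\ U y,
    `|'D_v ('D_u f) x - 'D_v ('D_u f) y| < e / 2 &
    `|'D_u ('D_v f) x - 'D_u ('D_v f) y| < e / 2].
  move/cvgrPdist_lt/(_ _ e2) : c1 => n1; move/cvgrPdist_lt/(_ _ e2) : c2 => n2.
  have n0 := open_nbhs_nbhs (conj oU Ux).
  apply: filterS (filterI n0 (filterI n1 n2)) => y [p0 [p1 p2]].
  by split; [exact: p0 | exact: p1 | exact: p2].
have [s t hs ht|s [t [hs ht E1]]] :=
  @second_difference f x u v h h0.
  have [Uy _ _] := hP s t hs ht.
  by split; apply: diff_derivable; [exact: df | exact: du].
have [t' s' ht' hs'|t' [s' [ht' hs' E2]]] :=
  @second_difference f x v u h h0.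
  have := hP s' t' hs' ht'; rewrite addrAC => -[Uy _ _].
  by split; apply: diff_derivable; [exact: df | exact: dv].
have [_ n1 _] := hP s t hs ht; have [_ _ n2] := hP s' t' hs' ht'.
rewrite (addrAC x (t' *: v)) (addrAC x (h *: v)) in E2.
have : h * h * 'D_v ('D_u f) (x + s *: u + t *: v) =
       h * h * 'D_u ('D_v f) (x + s' *: u + t' *: v).
  by apply: etrans (esym E1) _; apply: etrans _ E2; congr (_ + _); exact: addrAC.
have hh : h * h != 0 by rewrite mulf_neq0 // gt_eqF.
move=> /(mulfI hh) E.
rewrite (splitr e) -(subrKA ('D_v ('D_u f) (x + s *: u + t *: v))).
apply: le_trans (ler_normD _ _) (lerD (ltW n1) _).
by rewrite distrC [X in _ - X]E ltW.
Qed.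

End Schwarz.

Section Smooth.
Context {R : realType} {V W : normedModType R}.
Implicit Types (f g : V -> W) (U : set V).

Lemma smooth_ext U f g : open U -> (forall y, U y -> f y = g y) ->
  smooth_on U f -> smooth_on U g.
Proof. by move=> oU fg sf k; exact: Ck_ext (sf k). Qed.

Lemma smooth_sub U U' f : U' `<=` U -> smooth_on U f -> smooth_on U' f.
Proof. by move=> UU sf k; exact: Ck_sub (sf k). Qed.

Lemma smooth_cst U (w : W) : smooth_on U (fun=> w).
Proof. by move=> k; exact: Ck_cst. Qed.

Lemma smooth_add U f g : open U -> smooth_on U f -> smooth_on U g ->
  smooth_on U (fun x => f x + g x).
Proof. by move=> oU sf sg k; exact: Ck_add. Qed.

Lemma smooth_derive U f v : smooth_on U f -> smooth_on U ('D_v f).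
Proof. by move=> sf k; have [_ h] := sf k.+1; exact: h. Qed.

Lemma smooth_diff U f x : smooth_on U f -> U x -> differentiable f x.
Proof. by move=> sf Ux; have [df _] := sf 1; exact: df. Qed.

Lemma smooth_derivable U f x v : smooth_on U f -> U x -> derivable f x v.
Proof. by move=> sf Ux; exact/diff_derivable/(smooth_diff sf). Qed.

Lemma smooth_continuous U f x : smooth_on U f -> U x -> {for x, continuous f}.
Proof. by move=> sf Ux; exact: (sf 0). Qed.
End Smooth.

Section SmoothScalar.
Context {R : realType} {V : normedModType R}.
Implicit Types (f g : V -> R) (U : set V).

Lemma smooth_mul U f g : open U -> smooth_on U f -> smooth_on U g ->
  smooth_on U (fun x => f x * g x).
Proof. by move=> oU sf sg k; exact: Ck_mul. Qed.

Lemma smooth_inv U f : open U -> (forall x, U x -> f x != 0) -> smooth_on U f ->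
  smooth_on U (fun x => (f x)^-1).
Proof. by move=> oU f0 sf k; exact: Ck_inv. Qed.

Lemma smooth_sum U (m : nat) (F : 'I_m -> V -> R) : open U ->
  (forall i, smooth_on U (F i)) -> smooth_on U (fun x => \sum_i F i x).
Proof.
move=> oU sF; have -> : (fun x => \sum_i F i x) = \sum_i F i.
  by apply/funext => x; rewrite fct_sumE.
by apply: (@big_ind _ (smooth_on U)) => // [|f g]; [exact: smooth_cst | exact: smooth_add].
Qed.
End SmoothScalar.

Section SmoothRow.
Context {R : realType} {V : normedModType R} {N : nat}.
Implicit Types (f g : V -> 'rV[R]_N) (a : V -> R) (U : set V).

Lemma smooth_row U f : open U ->
  smooth_on U f <-> forall j, smooth_on U (fun y => f y 0 j).
Proof.
move=> oU; split=> [sf j k|sf k]; first exact: (Ck_row k f oU).1 (sf k) j.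
by apply/Ck_row => // j; exact: sf.
Qed.

End SmoothRow.

Section SmoothRowOperations.
Context {R : realType} {V : normedModType R} {N : nat}.
Implicit Types (f g : V -> 'rV[R]_N) (a : V -> R) (U : set V).

Lemma smooth_scale U a f : open U -> smooth_on U a -> smooth_on U f ->
  smooth_on U (fun x => a x *: f x).
Proof.
move=> oU sa /(smooth_row _ oU) sf; apply/(smooth_row _ oU) => j.
apply: (@smooth_ext _ _ _ _ (fun x => a x * f x 0 j)) => // [y _|]; first by rewrite mxE.
by apply: smooth_mul => //; exact: sf.
Qed.

Lemma smooth_dot U f g : open U -> smooth_on U f -> smooth_on U g ->
  smooth_on U (fun x => dot (f x) (g x)).
Proof.
move=> oU /(smooth_row _ oU) sf /(smooth_row _ oU) sg.
apply: (@smooth_ext _ _ _ _ (fun x => \sum_i f x 0 i * g x 0 i)) => // [y _|].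
  by rewrite dotE.
by apply: smooth_sum => // i; exact: smooth_mul.
Qed.

Lemma smooth_mulmx U f m (M : 'M[R]_(N, m)) : open U -> smooth_on U f ->
  smooth_on U (fun x => f x *m M).
Proof.
move=> oU /(smooth_row _ oU) sf; apply/(smooth_row _ oU) => j.
apply: (@smooth_ext _ _ _ _ (fun x => \sum_i f x 0 i * M i j)) => // [y _|].
  by rewrite mxE.
by apply: smooth_sum => // i; apply: smooth_mul => //; exact: smooth_cst.
Qed.

Lemma smooth_sub_row U f g : open U -> smooth_on U f -> smooth_on U g ->
  smooth_on U (fun x => f x - g x).
Proof.
move=> oU sf sg; apply: (@smooth_ext _ _ _ _ (fun x => f x + g x *m (- 1%:M))) => // [y _|].
  by rewrite mulmxN mulmx1.
by apply: smooth_add => //; exact: smooth_mulmx.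
Qed.

Lemma derive_scale a f x v : differentiable a x -> differentiable f x ->
  'D_v (fun y => a y *: f y) x = 'D_v a x *: f x + a x *: 'D_v f x.
Proof.
move=> da df; have dfj j := (differentiable_row f x).1 df j.
have daf : differentiable (fun y => a y *: f y) x.
  apply/differentiable_row => j.
  have -> : (fun y => (a y *: f y) 0 j) = (fun y => a y * f y 0 j).
    by apply/funext => y; rewrite mxE.
  exact: differentiableM.
apply/rowP => j; rewrite derive_row // !mxE !derive_row //.
have -> : (fun y => (a y *: f y) 0 j) = a * (fun y => f y 0 j).
  by apply/funext => y; rewrite mxE.
rewrite deriveM; [|exact: diff_derivable|exact: diff_derivable].
by rewrite addrC; congr (_ + _); exact: mulrC.
Qed.

Lemma differentiable_mulmx f m (M : 'M[R]_(N, m)) x :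
  differentiable f x -> differentiable (fun y => f y *m M) x.
Proof.
move=> df; have dfj j := (differentiable_row f x).1 df j.
apply/differentiable_row => j.
have -> : (fun y => (f y *m M) 0 j) = \sum_i (fun y => f y 0 i * M i j).
  by apply/funext => y; rewrite fct_sumE mxE.
by apply: differentiable_sum => i; exact: differentiableM.
Qed.

Lemma derive_mulmx f m (M : 'M[R]_(N, m)) x v : differentiable f x ->
  'D_v (fun y => f y *m M) x = 'D_v f x *m M.
Proof.
move=> df; have dfj j := (differentiable_row f x).1 df j.
apply/rowP => j; rewrite derive_row ?mxE; last exact: differentiable_mulmx.
have -> : (fun y => (f y *m M) 0 j) = \sum_i (M i j *: (fun y => f y 0 i)).
  by apply/funext => y; rewrite fct_sumE mxE; apply: eq_bigr => i _; rewrite mulrC.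
rewrite derive_sum => [|i]; last exact/derivableZ/diff_derivable.
apply: eq_bigr => i _; rewrite deriveZ; last exact/diff_derivable.
by rewrite derive_row //; exact: mulrC.
Qed.

Lemma derive_dot f g x v : differentiable f x -> differentiable g x ->
  'D_v (fun y => dot (f y) (g y)) x = dot ('D_v f x) (g x) + dot (f x) ('D_v g x).
Proof.
move=> df dg; have dfj j := (differentiable_row f x).1 df j.
have dgj j := (differentiable_row g x).1 dg j.
have -> : (fun y => dot (f y) (g y)) = \sum_i ((fun y => f y 0 i) * (fun y => g y 0 i)).
  by apply/funext => y; rewrite fct_sumE dotE.
rewrite derive_sum => [|i]; last by apply: derivableM; exact/diff_derivable.
rewrite !dotE -big_split /=; apply: eq_bigr => i _.
rewrite deriveM; [|exact: diff_derivable|exact: diff_derivable].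
by rewrite !derive_row // addrC; congr (_ + _); exact: mulrC.
Qed.

Lemma schwarz_row f U x u v : open U -> smooth_on U f -> U x ->
  'D_v ('D_u f) x = 'D_u ('D_v f) x.
Proof.
move=> oU sf Ux; apply/rowP => j.
have sfj := (smooth_row f oU).1 sf j.
have e w y : U y -> ('D_w f y) 0 j = 'D_w (fun y => f y 0 j) y.
  by move=> Uy; apply: derive_row; exact: (smooth_diff sf).
have e2 w w' : ('D_w ('D_w' f) x) 0 j = 'D_w ('D_w' (fun y => f y 0 j)) x.
  apply: etrans (derive_row _ _ (smooth_diff (smooth_derive w' sf) Ux)) _.
  exact: derive_open_ext oU Ux (e w').
by apply: etrans (e2 v u) _; apply: etrans (schwarz _ _ oU sfj Ux) _; apply/esym/e2.
Qed.
End SmoothRowOperations.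

(** * The chain rule for smooth maps *)

Section Composition.
Context {R : realType} {V : normedModType R} {m : nat}.

Lemma derive_rowE (W : normedModType R) (f : 'rV[R]_m -> W) x v :
  differentiable f x -> 'D_v f x = \sum_l v 0 l *: 'D_(delta_mx 0 l) f x.
Proof.
move=> df; rewrite deriveE // {1}(row_sum_delta v) linear_sum.
by apply: eq_bigr => l _; rewrite linearZ -deriveE.
Qed.

Lemma derive_comp (W : normedModType R) (t : V -> 'rV[R]_m) (f : 'rV[R]_m -> W) x v :
  differentiable t x -> differentiable f (t x) ->
  'D_v (f \o t) x = 'D_('D_v t x) f (t x).
Proof.
move=> dt df; rewrite !deriveE //; last exact: differentiable_comp.
by rewrite diff_comp.
Qed.

(** Induction on k for all [f] at once: a derivative of [f \o t] is a sum of products of a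
    derivative of [t] with a partial derivative of [f] composed with [t]. *)
Lemma Ck_comp k U U' (t : V -> 'rV[R]_m) (f : 'rV[R]_m -> R) : open U ->
  (forall x, U x -> U' (t x)) -> smooth_on U t -> smooth_on U' f -> Ck k U (f \o t).
Proof.
move=> oU UU st; elim: k f => [|k IH] f sf.
  move=> x Ux; apply: continuous_comp; first exact: (smooth_continuous st).
  exact/(smooth_continuous sf)/UU.
have dt x : U x -> differentiable t x by exact: smooth_diff.
have df x : U x -> differentiable f (t x) by move=> /UU; exact: smooth_diff.
split=> [x Ux|v]; first by apply: differentiable_comp; [exact: dt | exact: df].
apply: (@Ck_ext _ _ _ _ _
  (fun y => \sum_l 'D_v t y 0 l * ('D_(delta_mx 0 l) f \o t) y)) => // [y Uy|].
  by rewrite derive_comp ?derive_rowE //; [exact: df | exact: dt | exact: df].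
have -> : (fun y => \sum_l 'D_v t y 0 l * ('D_(delta_mx 0 l) f \o t) y) =
  \sum_l (fun y => 'D_v t y 0 l * ('D_(delta_mx 0 l) f \o t) y).
  by apply/funext => x; rewrite fct_sumE.
apply: (@big_ind _ (Ck k U)) => [|f1 f2|l _]; [exact: Ck_cst | exact: Ck_add |].
apply: Ck_mul => //; last exact/IH/smooth_derive.
exact: ((smooth_row _ oU).1 (smooth_derive v st) l k).
Qed.

Lemma smooth_comp U U' (t : V -> 'rV[R]_m) (f : 'rV[R]_m -> R) : open U ->
  (forall x, U x -> U' (t x)) -> smooth_on U t -> smooth_on U' f ->
  smooth_on U (f \o t).
Proof. by move=> oU UU st sf k; exact: Ck_comp st sf. Qed.

Lemma smooth_comp_row N U U' (t : V -> 'rV[R]_m) (f : 'rV[R]_m -> 'rV[R]_N) :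
  open U -> open U' ->
  (forall x, U x -> U' (t x)) -> smooth_on U t -> smooth_on U' f ->
  smooth_on U (f \o t).
Proof.
move=> oU oU' UU st /(smooth_row _ oU') sf; apply/(smooth_row _ oU) => j.
exact: (smooth_comp oU UU st (sf j)).
Qed.
End Composition.

(** * Osculating spaces of holomorphic curves *)

Section Sections.
Context {R : realType} {m N : nat} (I : 'M[R]_N).
Hypothesis I_cs : parallel_complex_structure I.
Implicit Types (U : set 'rV[R]_m) (f g : 'rV[R]_m -> 'rV[R]_N) (a : 'rV[R]_m -> R).

(* The sections of the module over the complex valued smooth functions on U
   that is generated by z_0, ..., z_(k-1). *)
Inductive csection (z : nat -> 'rV[R]_m -> 'rV[R]_N) U (k : nat) :
    ('rV[R]_m -> 'rV[R]_N) -> Prop :=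
| csection_gen i of (i < k)%N : csection z U k (z i)
| csection_zero : csection z U k (fun=> 0)
| csection_I f of csection z U k f : csection z U k (fun y => f y *m I)
| csection_add f g of csection z U k f & csection z U k g : csection z U k (fun y => f y + g y)
| csection_scale a f of smooth_on U a & csection z U k f : csection z U k (fun y => a y *: f y)
| csection_ext f g of (forall y, U y -> f y = g y) & csection z U k f : csection z U k g.

Variable z : nat -> 'rV[R]_m -> 'rV[R]_N.

Lemma csection_le U k l f : (k <= l)%N -> csection z U k f -> csection z U l f.
Proof.
move=> kl; elim=> [i ik||{}f _ h|{}f g _ hf _ hg|a {}f sa _ h|{}f g e _ h].
- by apply: csection_gen; exact: leq_trans kl.
- exact: csection_zero.
- exact: csection_I.
- exact: csection_add.
- exact: csection_scale.
- exact: csection_ext h.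
Qed.

Lemma csection_subset U U' k f : U' `<=` U -> csection z U k f -> csection z U' k f.
Proof.
move=> UU; elim=> [i ik||{}f _ h|{}f g _ hf _ hg|a {}f sa _ h|{}f g e _ h].
- exact: csection_gen.
- exact: csection_zero.
- exact: csection_I.
- exact: csection_add.
- by apply: csection_scale => //; exact: smooth_sub sa.
- by apply: csection_ext h => y /UU; exact: e.
Qed.

Lemma csection_mem U k f y : csection z U k f -> U y -> f y \in complex_flag I (z^~ y) k.
Proof.
move=> Of Uy; elim: Of => [i ik||{}f _ h|{}f g _ hf _ hg|a {}f sa _ h|{}f g e _ h].
- exact: (complex_flag_mem _ (z^~ y)).
- exact: mem0v.
- exact: complex_flag_stable.
- exact: memvD.
- exact: memvZ.
- by rewrite -e.
Qed.

Lemma csection_scalel U k c f : csection z U k f -> csection z U k (fun y => c *: f y).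
Proof. by apply: csection_scale; exact: smooth_cst. Qed.

Lemma csection_sub U k f g : csection z U k f -> csection z U k g -> csection z U k (fun y => f y - g y).
Proof.
move=> hf hg; apply: (@csection_ext _ _ _ (fun y => f y + (-1) *: g y)) => [y _|].
  by rewrite scaleN1r.
exact/csection_add/csection_scalel.
Qed.

Lemma csection_sum U k (F : 'I_m -> 'rV[R]_m -> 'rV[R]_N) :
  (forall i, csection z U k (F i)) -> csection z U k (fun y => \sum_i F i y).
Proof.
move=> sF; have -> : (fun x => \sum_i F i x) = \sum_i F i.
  by apply/funext => x; rewrite fct_sumE.
by apply: (@big_ind _ (csection z U k)) => // [|f g]; [exact: csection_zero | exact: csection_add].
Qed.

Section Smooth.
Variable U : set 'rV[R]_m.
Hypothesis oU : open U.

Lemma csection_smooth k f : (forall i, (i < k)%N -> smooth_on U (z i)) ->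
  csection z U k f -> smooth_on U f.
Proof.
move=> sz; elim=> [i ik||{}f _ h|{}f g _ hf _ hg|a {}f sa _ h|{}f g e _ h].
- exact: sz.
- exact: smooth_cst.
- exact: smooth_mulmx.
- exact: smooth_add.
- exact: smooth_scale.
- exact: smooth_ext h.
Qed.

(** By the Leibniz rule only the generators need checking; [k <= l] absorbs the term in which a
    coefficient is differentiated. *)
Lemma csection_derive k l v f : (k <= l)%N -> (forall i, (i < k)%N -> smooth_on U (z i)) ->
  (forall i, (i < k)%N -> csection z U l ('D_v (z i))) ->
  csection z U k f -> csection z U l ('D_v f).
Proof.
move=> kl sz Dz; elim=> [i ik||{}f Of h|{}f g Of hf Og hg|a {}f sa Of h|{}f g e _ h].
- exact: Dz.
- apply: csection_ext (csection_zero _ _ _) => y _.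
  by apply/esym; exact: derive_cst.
- apply: csection_ext (csection_I h) => y Uy; rewrite derive_mulmx //.
  exact: smooth_diff (csection_smooth sz Of) Uy.
- apply: csection_ext (csection_add hf hg) => y Uy; apply/esym/(@deriveD _ _ _ f g).
    exact: smooth_derivable (csection_smooth sz Of) Uy.
  exact: smooth_derivable (csection_smooth sz Og) Uy.
- apply: (@csection_ext _ _ _ (fun y => 'D_v a y *: f y + a y *: 'D_v f y)) => [y Uy|].
    by rewrite derive_scale //; apply: smooth_diff Uy => //; exact: csection_smooth Of.
  apply: csection_add; apply: csection_scale => //; first exact: smooth_derive.
  exact: csection_le Of.
- by apply: csection_ext h => y Uy; have := (@derive_open_ext _ _ _ U f g y v oU Uy e).
Qed.

Lemma csection_derive_field l (X : 'rV[R]_m -> 'rV[R]_m) f : smooth_on U X ->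
  (forall y, U y -> differentiable f y) ->
  (forall v, csection z U l ('D_v f)) -> csection z U l (fun y => 'D_(X y) f y).
Proof.
move=> sX df h.
apply: (@csection_ext _ _ _ (fun y => \sum_l X y 0 l *: 'D_(delta_mx 0 l) f y)) => [y Uy|].
  by rewrite (derive_rowE _ (df y Uy)).
by apply: csection_sum => i; apply: csection_scale => //; exact: ((smooth_row X oU).1 sX i).
Qed.

(** The residuals of the generators do not vanish on U, so every Gram-Schmidt step has smooth
    coefficients. The second conclusion turns pointwise membership in the flag into smooth
    coefficients. *)
Lemma csection_perp k f : (forall i, (i < k)%N -> smooth_on U (z i)) ->
  (forall i y, (i < k)%N -> U y -> flag_perp I (z^~ y) i != 0) -> smooth_on U f ->
  smooth_on U (fun y => perp_proj (complex_flag I (z^~ y) k) (f y)) /\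
  csection z U k (fun y => f y - perp_proj (complex_flag I (z^~ y) k) (f y)).
Proof.
elim: k f => [|k IH] f sz nz sf.
  have e y : perp_proj (complex_flag I (z^~ y) 0) (f y) = f y.
    by apply: perp_proj_id => v; rewrite memv0 => /eqP->; rewrite dot0r.
  split; first by apply: smooth_ext sf.
  by apply: csection_ext (csection_zero _ _ _) => y _; rewrite e subrr.
have sz' i : (i < k)%N -> smooth_on U (z i) by move=> ik; exact/sz/ltnW.
have nz' i y : (i < k)%N -> U y -> flag_perp I (z^~ y) i != 0.
  by move=> ik; apply/nz/ltnW.
have [sp Op] := IH f sz' nz' sf.
have [se Oe] := IH (z k) sz' nz' (sz k (ltnSn k)).
set p := fun y => perp_proj _ (f y) in sp Op.
have se' : smooth_on U (fun y => flag_perp I (z^~ y) k) by [].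
have see : smooth_on U (fun y => (dot (flag_perp I (z^~ y) k) (flag_perp I (z^~ y) k))^-1).
  apply: smooth_inv => // [y Uy|]; first by rewrite dot_eq0 nz.
  exact: smooth_dot.
have sc : smooth_on U (fun y => cproj I (flag_perp I (z^~ y) k) (p y)).
  apply: smooth_add => //; apply: smooth_scale => //; last exact: smooth_mulmx.
    by apply: smooth_mul => //; exact: smooth_dot.
  by apply: smooth_mul => //; apply: smooth_dot => //; exact: smooth_mulmx.
have Oeta : csection z U k.+1 (fun y => flag_perp I (z^~ y) k).
  apply: (@csection_ext _ _ _ (fun y => z k y - (z k y - flag_perp I (z^~ y) k))) => [y _|].
    by rewrite subKr.
  by apply: csection_sub; [exact: csection_gen | exact: csection_le Oe].
have Oc : csection z U k.+1 (fun y => cproj I (flag_perp I (z^~ y) k) (p y)).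
  apply: csection_add; apply: csection_scale => //; last exact: csection_I.
    by apply: smooth_mul => //; exact: smooth_dot.
  by apply: smooth_mul => //; apply: smooth_dot => //; exact: smooth_mulmx.
split.
  apply: (@smooth_ext _ _ _ _ (fun y => p y - cproj I (flag_perp I (z^~ y) k) (p y))) => // [y _|].
    by rewrite perp_complex_flagS.
  exact: smooth_sub_row.
apply: (@csection_ext _ _ _ (fun y => (f y - p y) + cproj I (flag_perp I (z^~ y) k) (p y))) => [y _|].
  by rewrite perp_complex_flagS // opprB [RHS]addrA [RHS]addrAC.
by apply: csection_add => //; exact: csection_le Op.
Qed.
End Smooth.

End Sections.

Lemma orth_complex_flag (R : realType) (N : nat) (I : 'M[R]_N) (z : nat -> 'rV[R]_N) k v :
  (forall i, (i < k)%N -> dot v (z i) = 0 /\ dot v (z i *m I) = 0) ->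
  orth (complex_flag I z k) v.
Proof.
elim: k => [|k IH] h; first by move=> u; rewrite memv0 => /eqP->; rewrite dot0r.
apply: orth_addv; first by apply: IH => i ik; exact/h/ltnW.
by have [h1 h2] := h k (ltnSn k); apply: orth_addv; exact: orth_line.
Qed.

(** Mean value theorem along a radius, one coordinate at a time. *)
Lemma derive0_ball (R : realType) (V : normedModType R) (N : nat)
    (f : V -> 'rV[R]_N) (x : V) (e : R) :
  (forall y, ball x e y -> differentiable f y) ->
  (forall y, ball x e y -> forall v, 'D_v f y = 0) ->
  forall y, ball x e y -> f y = f x.
Proof.
move=> df Df y By; apply/rowP => j; pose u := y - x.
have Bt (t : R) : 0 <= t <= 1 -> ball x e (x + t *: u).
  move=> /andP[t0 t1]; move: By; rewrite -!ball_normE /= opprD addrA subrr add0r normrN normrZ.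
  rewrite distrC; apply: le_lt_trans; rewrite ger0_norm // ler_piMl //.
pose g (t : R) : R := f (x + t *: u) 0 j.
have dg (t : R) : 0 <= t <= 1 -> is_derive t (1 : R) g 0.
  move=> ht; have dfx := df _ (Bt t ht).
  have <- : 'D_u (fun y => f y 0 j) (x + t *: u) = 0.
    by rewrite -derive_row // Df ?mxE //; exact: Bt.
  apply: (@is_derive_line _ _ _ (fun y => f y 0 j)).
  exact/diff_derivable/(differentiable_row f _).1.
have [||s _] := @MVT_segment R g (fun=> 0) 0 1 ler01.
- by move=> t; rewrite in_itv /= => /andP[t0 t1]; apply: dg; rewrite !ltW.
- apply: derivable_within_continuous => t; rewrite in_itv /= => ht.
  by have [] := dg t ht.
rewrite mul0r => /eqP; rewrite subr_eq0 /g scale1r scale0r addr0 /u => /eqP <-.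
by rewrite addrC subrK.
Qed.

(** * Higher normal spaces of a holomorphic patch *)

Section HolomorphicPatch.
Context {R : realType} {n : nat} (I : 'M[R]_n.+2).
Hypothesis I_cs : parallel_complex_structure I.
Notation E := 'rV[R]_n.+2.
Notation field := ('rV[R]_2 -> 'rV[R]_2).

(* In the chart, holomorphy makes the second partial derivative of G a complex
   multiple of the first one. By Schwarz' theorem all partial derivatives of G
   of order at most k are then complex combinations of
   xi_0, ..., xi_(k-1). *)
Definition xi (G : 'rV[R]_2 -> E) (k : nat) : 'rV[R]_2 -> E :=
  iter k.+1 (fun f => 'D_(delta_mx 0 0) f) G.

(** Mind the shift: index 1 is the tangent plane, and N_1 + ... + N_k completes it to index k +
    1. *)
Definition osculating (G : 'rV[R]_2 -> E) k y := complex_flag I (fun i => xi G i y) k.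

Definition xi_perp (G : 'rV[R]_2 -> E) k y := flag_perp I (fun i => xi G i y) k.

Variables (G : 'rV[R]_2 -> E) (U0 : set 'rV[R]_2) (J : 'rV[R]_2 -> field).
Hypothesis oU0 : open U0.
Hypothesis sG : smooth_on U0 G.
Hypothesis xi0 : forall y, U0 y -> xi G 0 y != 0.
Hypothesis G_span : forall y u, U0 y -> 'D_u G y \in cspan I (xi G 0 y).
Hypothesis G_J : forall y u, U0 y -> 'D_(J y u) G y = 'D_u G y *m I.

Notation z := (xi G).
Notation O := (csection I z).
Notation d1 := (delta_mx 0 0 : 'rV[R]_2).

Lemma smooth_xi k : smooth_on U0 (z k).
Proof. by elim: k => [|k IH]; exact: smooth_derive. Qed.

(** Symmetry of second derivatives moves the arbitrary direction v innermost, where [G_span]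
    controls it. *)
Lemma derive_comm_xi v k y : U0 y ->
  'D_v (z k) y = iter k.+1 (fun f => 'D_d1 f) ('D_v G) y.
Proof.
have sD w j : smooth_on U0 (iter j (fun f => 'D_d1 f) ('D_w G)).
  by elim: j => [|j IH]; exact: smooth_derive.
elim: k y => [|k IH] y Uy; first exact: (schwarz_row _ _ oU0 sG Uy).
apply: etrans (schwarz_row _ _ oU0 (smooth_xi k) Uy) _.
exact: (@derive_open_ext _ _ _ U0 ('D_v (z k)) (iter k.+1 (fun f => 'D_d1 f) ('D_v G)) y d1 oU0 Uy IH).
Qed.

Section OnOpen.
Variable U : set 'rV[R]_2.
Hypothesis oU : open U.
Hypothesis UU0 : U `<=` U0.

Let sz i : smooth_on U (z i).
Proof. exact/smooth_sub/smooth_xi. Qed.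

Let perp0 i y : (i < 1)%N -> U y -> flag_perp I (z^~ y) i != 0.
Proof.
rewrite ltnS leqn0 => /eqP-> /UU0/xi0; rewrite /flag_perp perp_proj_id // => v.
by rewrite memv0 => /eqP->; rewrite dot0r.
Qed.

(** Since xi_0 does not vanish, pointwise membership in its complex line yields smooth
    coefficients. *)
Lemma csection_tangent f : smooth_on U f -> (forall y, U y -> f y \in cspan I (z 0 y)) ->
  O U 1 f.
Proof.
move=> sf fT; have [_ Of] := csection_perp I_cs oU (fun i _ => sz i) perp0 sf.
by apply: csection_ext Of => y Uy; rewrite perp_proj0 ?subr0 //= add0v; exact: fT.
Qed.

Lemma csection_DG v : O U 1 ('D_v G).
Proof.
apply: csection_tangent; first exact: (smooth_sub UU0 (smooth_derive v sG)).
by move=> y /UU0/G_span.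
Qed.

(** The derivative of xi_i along v is that of [G] along v, differentiated i + 1 more times in the
    first coordinate. The former has order 1 and each further derivative adds 1. *)
Lemma csection_Dxi v i : O U i.+2 ('D_v (z i)).
Proof.
suff h j : O U j.+1 (iter j (fun f => 'D_d1 f) ('D_v G)).
  by apply: csection_ext (h i.+1) => y /UU0 Uy; rewrite derive_comm_xi.
elim: j => [|j IH]; first exact: csection_DG.
by apply: csection_derive IH => // l lj; exact: (@csection_gen _ _ _ I z U j.+2 l.+1).
Qed.

Lemma csection_D k v f : O U k f -> O U k.+1 ('D_v f).
Proof.
apply: csection_derive => // i ik; apply: csection_le (csection_Dxi v i); exact: ik.
Qed.

Lemma csection_DX k X f : smooth_on U X -> O U k f -> O U k.+1 (fun y => 'D_(X y) f y).
Proof.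
move=> sX Of; apply: csection_derive_field => // [y Uy|v]; last exact: csection_D.
exact: (smooth_diff (csection_smooth oU (fun i _ => sz i) Of)).
Qed.

Lemma tangent_atE y : U0 y -> tangent_at G y = cspan I (z 0 y).
Proof.
move=> Uy; apply: vspan_eq => [_ [u _ <-]|V hV]; first exact: G_span.
rewrite subv_add -!memvE /z /= hV; last by exists d1.
by rewrite /= -G_J // hV //; exists (J y d1).
Qed.

Lemma normal_projE y v : U0 y -> normal_proj G y v = perp_proj (osculating G 1 y) v.
Proof. by move=> Uy; rewrite /normal_proj tangent_atE // /osculating /= add0v. Qed.

Lemma csection_normal f : smooth_on U f -> O U 1 (fun y => f y - normal_proj G y (f y)).
Proof.
move=> sf; have [_ Of] := csection_perp I_cs oU (fun i _ => sz i) perp0 sf.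
by apply: csection_ext Of => y /UU0 Uy; rewrite normal_projE.
Qed.

Lemma csection_normal_proj k f : O U k.+1 f -> O U k.+1 (fun y => normal_proj G y (f y)).
Proof.
move=> Of; apply: (@csection_ext _ _ _ _ _ _ _ (fun y => f y - (f y - normal_proj G y (f y)))).
  by move=> y _; rewrite subKr.
apply: csection_sub => //; apply: csection_le (csection_normal _) => //.
exact: (csection_smooth oU (fun i _ => sz i) Of).
Qed.

End OnOpen.

(** Each differentiation raises the order by one, and the normal projection only adds a section of
    order 1. Every field is smooth on a neighbourhood of its own, which is why U depends on j. *)
Lemma nabla_iter_csection (X : nat -> field) x j : U0 x -> (forall i, smooth_near x (X i)) ->
  exists U, [/\ open U, U x, U `<=` U0 & O U j.+2 (nabla_iter G X j)].
Proof.
move=> U0x sX; elim: j => [|j [U [oU Ux UU0 hU]]] /=.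
  have [U1 [oU1 U1x s1]] := sX 1; have [U2 [oU2 U2x s2]] := sX 2.
  have oU := openI oU0 (openI oU1 oU2); set U := _ `&` _ in oU.
  have UU0 : U `<=` U0 by move=> y [].
  exists U; split=> //; apply: csection_normal_proj => //; apply: csection_DX => //.
    by apply: smooth_sub s2 => y [_ []].
  apply: csection_derive_field => // [|y [U0y _]|v].
  - by apply: smooth_sub s1 => y [_ []].
  - exact: smooth_diff sG U0y.
  - exact: csection_DG.
have [U1 [oU1 U1x s1]] := sX j.+3.
exists (U `&` U1); have oU' := openI oU oU1; have UU' : U `&` U1 `<=` U0.
  by move=> y [/UU0].
split=> //; apply: csection_normal_proj => //; apply: csection_DX => //.
  by apply: smooth_sub s1 => y [].
by apply: csection_subset hU => y [].
Qed.

Notation X1 := (fun _ : nat => fun _ : 'rV[R]_2 => d1).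

(** The leading term is the plain iterated derivative: a projection alters it by a section of order
    1, and differentiating the accumulated error raises its order by one. *)
Lemma nabla_iter_d1 j : O U0 j.+1 (fun y => nabla_iter G X1 j y - z j.+1 y).
Proof.
have h f : smooth_on U0 f -> O U0 1 (fun y => normal_proj G y (f y) - f y).
  move=> sf; apply: (@csection_ext _ _ _ _ _ _ _ (fun y => (-1) *: (f y - normal_proj G y (f y)))).
    by move=> y _; rewrite scaleN1r opprB.
  exact/csection_scalel/csection_normal.
elim: j => [|j IH]; first exact: (h (z 1%N) (smooth_xi 1)).
have sN : smooth_on U0 (nabla_iter G X1 j).
  apply: (@smooth_ext _ _ _ _ (fun y => (nabla_iter G X1 j y - z j.+1 y) + z j.+1 y)) => //.
    by move=> y _; rewrite subrK.
  apply: smooth_add => //; last exact: smooth_xi.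
  exact: (csection_smooth oU0 (fun i _ => smooth_xi i) IH).
apply: (@csection_ext _ _ _ _ _ _ _ (fun y =>
  (normal_proj G y ('D_d1 (nabla_iter G X1 j) y) - 'D_d1 (nabla_iter G X1 j) y) +
  'D_d1 (fun y => nabla_iter G X1 j y - z j.+1 y) y)) => [y Uy|].
  rewrite (@deriveB _ _ _ (nabla_iter G X1 j) (z j.+1)) ?addrA ?subrK //.
    exact: smooth_derivable sN Uy.
  exact: smooth_derivable (smooth_xi _) Uy.
apply: csection_add; last exact: csection_D.
by apply: csection_le (h _ _) => //; exact: smooth_derive.
Qed.

Lemma smooth_nabla_iter_d1 j : smooth_on U0 (nabla_iter G X1 j).
Proof.
apply: (@smooth_ext _ _ _ _ (fun y => (nabla_iter G X1 j y - z j.+1 y) + z j.+1 y)) => //.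
  by move=> y _; rewrite subrK.
apply: smooth_add => //; last exact: smooth_xi.
exact: (csection_smooth oU0 (fun i _ => smooth_xi i) (nabla_iter_d1 j)).
Qed.

Lemma osculating_stable k y : Istable I (osculating G k y).
Proof. exact: complex_flag_stable. Qed.

Lemma normal_projI y v : U0 y -> normal_proj G y (v *m I) = normal_proj G y v *m I.
Proof. by move=> Uy; rewrite !normal_projE // perp_projI //; exact: osculating_stable. Qed.

(** Slot 1 is the innermost one of [nabla_iter]: rotating its field multiplies the function that is
    differentiated first by I, and I commutes with derivatives and with the normal projection. *)
Lemma nabla_iter_I (Y : nat -> field) U j y : open U -> U `<=` U0 -> U y ->
  (forall i, i != 1%N -> Y i = fun=> d1) ->
  (forall x, U x -> 'D_(Y 1%N x) G x = 'D_d1 G x *m I) ->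
  nabla_iter G Y j y = nabla_iter G X1 j y *m I.
Proof.
move=> oU UU0 Uy hY YI; elim: j y Uy => [|j IH] y Uy.
  rewrite /= /second_form (hY 2%N) // -normal_projI; last exact: UU0.
  congr normal_proj; rewrite -derive_mulmx; last exact/(smooth_diff (smooth_xi 0))/UU0.
  exact: (@derive_open_ext _ _ _ U (fun x => 'D_(Y 1%N x) G x)
            (fun x => 'D_d1 G x *m I) y d1 oU Uy YI).
rewrite /= /nabla_perp (hY j.+3) // -normal_projI; last exact: UU0.
congr normal_proj; rewrite -derive_mulmx.
  exact: (@derive_open_ext _ _ _ U (nabla_iter G Y j)
            (fun x => nabla_iter G X1 j x *m I) y d1 oU Uy IH).
exact/(smooth_diff (smooth_nabla_iter_d1 j))/UU0.
Qed.

Lemma nabla_iter_orth X j y : U0 y -> orth (osculating G 1 y) (nabla_iter G X j y).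
Proof.
by move=> Uy; case: j => [|j] /=; rewrite /second_form /nabla_perp normal_projE //;
  exact: perp_proj_orth.
Qed.

Lemma xi_perp_orth k y : orth (osculating G k y) (xi_perp G k y).
Proof. exact: perp_proj_orth. Qed.

Lemma perp_proj_osculating k y v : v \in osculating G k.+1 y ->
  perp_proj (osculating G k y) v \in cspan I (xi_perp G k y).
Proof.
rewrite /osculating complex_flagS_perp // => /memv_addP[a aO [b bE ->]].
rewrite perp_projD perp_proj0 // add0r perp_proj_id //.
move/cspanP: bE => [c [d ->]]; apply: orthD; apply: orthZ; first exact: xi_perp_orth.
exact/orthI/xi_perp_orth/osculating_stable.
Qed.

Lemma perp_nabla_d1 k y : U0 y ->
  perp_proj (osculating G k.+1 y) (nabla_iter G X1 k y) = xi_perp G k.+1 y.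
Proof.
by move=> Uy; apply: perp_proj_eqmod; exact: (csection_mem I_cs (nabla_iter_d1 k) Uy).
Qed.

Let c1 y := dot ('D_(delta_mx 0 1) G y) (z 0 y) / dot (z 0 y) (z 0 y).
Let c2 y := dot ('D_(delta_mx 0 1) G y) (z 0 y *m I) / dot (z 0 y) (z 0 y).

(** [J] carries no smoothness here, while the normal spaces are tested on smooth fields. The
    equation for X is therefore solved explicitly in the coordinate frame: X is (d2 - c1 d1) /
    c2. *)
Lemma smooth_near_J y : U0 y -> exists2 X : field, smooth_near y X &
  forall x, U0 x -> 'D_(X x) G x = z 0 x *m I.
Proof.
move=> Uy.
have d2E x : U0 x -> 'D_(delta_mx 0 1) G x = c1 x *: z 0 x + c2 x *: (z 0 x *m I).
  move=> Ux; rewrite -[RHS]/(cproj I (z 0 x) ('D_(delta_mx 0 1) G x)).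
  by apply/eqP; rewrite -subr_eq0 -cproj_perp // perp_proj_eq0 G_span.
have DE x u : U0 x -> 'D_u G x = u 0 0 *: z 0 x + u 0 1 *: 'D_(delta_mx 0 1) G x.
  move=> Ux; rewrite derive_rowE; last exact: (smooth_diff sG Ux).
  by rewrite big_ord_recl big_ord1 (_ : lift ord0 ord0 = 1) //; exact: val_inj.
(* If c2 vanished, xi_0 I would be a real multiple of xi_0, although it is orthogonal to xi_0 and of
   the same length. *)
have c20 x : U0 x -> c2 x != 0.
  move=> Ux; apply/eqP => c0; have := G_J d1 Ux; rewrite DE // d2E // c0 scale0r addr0.
  rewrite scalerA -scalerDl => e; have := dotI0 I_cs (z 0 x).
  rewrite -[_ *m I]e => /eqP; rewrite dotZr mulf_eq0 dot_eq0 (negPf (xi0 Ux)) orbF => /eqP h.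
  have := xi0 Ux; rewrite -dot_eq0 -(dotII I_cs) -[_ *m I]e h scale0r dot0l eqxx //.
have sc f : smooth_on U0 f -> smooth_on U0 (fun x => dot ('D_(delta_mx 0 1) G x) (f x) / dot (z 0 x) (z 0 x)).
  move=> sf; apply: smooth_mul => //; first by apply: smooth_dot => //; exact: smooth_derive.
  apply: smooth_inv => // [x Ux|]; first by rewrite dot_eq0 xi0.
  by apply: smooth_dot => //; exact: (smooth_xi 0).
exists (fun x => (c2 x)^-1 *: (delta_mx 0 1 - c1 x *: d1)).
  exists U0; split=> //; apply: smooth_scale => //.
    by apply: smooth_inv => //; apply: sc; apply: smooth_mulmx => //; exact: (smooth_xi 0).
  apply: smooth_sub_row => //; first exact: smooth_cst.
  by apply: smooth_scale => //; [exact/sc/(smooth_xi 0) | exact: smooth_cst].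
move=> x Ux; rewrite DE // d2E // !mxE /= !mulr1n !mulr0n.
rewrite mulr0 subr0 mulr1 sub0r mulr1 scalerDr !scalerA mulVf ?c20 // scale1r addrA.
by rewrite -scalerDl mulrN addNr scale0r add0r.
Qed.

(** Upper bound: by [nabla_iter_csection] every iterated derivative lies in the osculating space of
    order k + 2. Lower bound: the constant field gives eta_(k+1), and rotating the field in slot 1
    gives its multiple by I. *)
Lemma nsum_piece k y : U0 y ->
  (osculating G 1 y + nsum_at G k y)%VS = osculating G k.+1 y ->
  (forall s, s \in nsum_at G k y -> orth (osculating G 1 y) s) ->
  vspan [set perp_proj (nsum_at G k y) (nabla_iter G X k y) | X in
           [set X : nat -> field | forall i, smooth_near y (X i)]] =
  cspan I (xi_perp G k.+1 y).
Proof.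
move=> Uy hO hS.
have pE X : perp_proj (nsum_at G k y) (nabla_iter G X k y) =
    perp_proj (osculating G k.+1 y) (nabla_iter G X k y).
  by rewrite -hO perp_proj_addv //; exact: nabla_iter_orth.
apply: vspan_eq => [_ [X sX <-]|V hV].
  rewrite pE; apply: perp_proj_osculating.
  have [U [_ Ux _ /(csection_mem I_cs)]] := nabla_iter_csection k Uy sX; exact.
have sd1 : smooth_near y (fun _ : 'rV[R]_2 => d1).
  by exists U0; split=> //; exact: smooth_cst.
rewrite subv_add -!memvE -(perp_nabla_d1 k Uy) -pE hV /=; last by exists X1.
have [X sX XE] := smooth_near_J Uy.
pose Y i := if i == 1%N then X else fun=> d1.
have := @nabla_iter_I Y U0 k y oU0 (@subset_refl _ _) Uy _ XE.
rewrite pE -perp_projI; [|exact: I_cs|exact: osculating_stable].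
move=> <-; last by rewrite /Y => i /negPf ->.
by rewrite -pE hV //; exists Y => // i; rewrite /Y; case: ifP.
Qed.

(** The two claims go through one induction, as [nsum_piece] needs both to compute the next
    summand. *)
Lemma nsum_osculating k y : U0 y ->
  (osculating G 1 y + nsum_at G k y)%VS = osculating G k.+1 y /\
  (forall s, s \in nsum_at G k y -> orth (osculating G 1 y) s).
Proof.
move=> Uy; elim: k => [|k [hO hS]].
  split; first by rewrite /= addv0.
  by move=> s; rewrite memv0 => /eqP-> v _; rewrite dot0l.
have -> : nsum_at G k.+1 y = (nsum_at G k y + cspan I (xi_perp G k.+1 y))%VS.
  by rewrite /= nsum_piece.
split; first by rewrite addvA hO /osculating [in RHS]complex_flagS_perp.
move=> _ /memv_addP[a aN [b bE ->]]; apply: orthD; first exact: hS.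
have l1 : (osculating G 1 y <= osculating G k.+1 y)%VS by exact: complex_flag_le.
apply: (orthS l1).
move/cspanP: bE => [c [d ->]]; apply: orthD; apply: orthZ; first exact: xi_perp_orth.
exact/orthI/xi_perp_orth/osculating_stable.
Qed.

Lemma nspace_atE k y : U0 y -> (0 < k)%N ->
  nspace_at G k y = cspan I (xi_perp G k y).
Proof.
case: k => // k Uy _; have [hO hS] := nsum_osculating k Uy.
by rewrite -(nsum_piece Uy hO hS) /nspace_at /higher_form subSS subSS subn0.
Qed.

Lemma perp_nsum_nabla k X y : U0 y ->
  perp_proj (nsum_at G k y) (nabla_iter G X k y) =
  perp_proj (osculating G k.+1 y) (nabla_iter G X k y).
Proof.
move=> Uy; have [hO hS] := nsum_osculating k Uy.
by rewrite -hO perp_proj_addv //; exact: nabla_iter_orth.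
Qed.

Lemma higher_form_d1 k y : U0 y -> (0 < k)%N ->
  higher_form G k.+1 X1 y = xi_perp G k y.
Proof.
case: k => // k Uy _; rewrite /higher_form subSS subSS subn0.
by rewrite perp_nsum_nabla // perp_nabla_d1.
Qed.

Lemma higher_form_I k Y y : U0 y -> (0 < k)%N ->
  (forall i, i != 1%N -> Y i = fun=> d1) ->
  (forall x, U0 x -> 'D_(Y 1%N x) G x = 'D_d1 G x *m I) ->
  higher_form G k.+1 Y y = xi_perp G k y *m I.
Proof.
case: k => // k Uy _ hY YI; rewrite /higher_form subSS subSS subn0 perp_nsum_nabla //.
rewrite (nabla_iter_I k oU0 (@subset_refl _ _) Uy hY YI).
by rewrite perp_projI ?perp_nabla_d1 //; exact: osculating_stable.
Qed.

Lemma tangent_osculating y : U0 y -> tangent_at G y = osculating G 1 y.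
Proof. by move=> Uy; rewrite tangent_atE // /osculating /= add0v. Qed.

Lemma osculating2 y : U0 y -> osculating G 2 y = (tangent_at G y + nspace_at G 1 y)%VS.
Proof. by move=> Uy; rewrite tangent_osculating // nspace_atE // /osculating complex_flagS_perp. Qed.

(** The residual of order k is known to be continuous only where the earlier ones are nonzero, so
    the neighbourhood is shrunk one order at a time. *)
Lemma flag_perp_neq0_open k y0 U : open U -> U `<=` U0 -> U y0 ->
  (forall j, (j < k)%N -> xi_perp G j y0 != 0) ->
  exists U', [/\ open U', U' y0, U' `<=` U &
    forall j y, (j < k)%N -> U' y -> xi_perp G j y != 0].
Proof.
move=> oU UU0 Uy; elim: k => [|k IH] h; first by exists U; split.
have [|U' [oU' U'y U'U nz]] := IH; first by move=> j jk; exact/h/ltnW.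
have U'U0 : U' `<=` U0 by move=> y /U'U/UU0.
have [sp _] := csection_perp I_cs oU' (fun i _ => smooth_sub U'U0 (smooth_xi i)) nz
  (smooth_sub U'U0 (smooth_xi k)).
have cp : {for y0, continuous (xi_perp G k)} by exact: (smooth_continuous sp U'y).
pose P := [set y | xi_perp G k y != 0].
have nP : nbhs y0 P by apply: (cvgr_neq0 _ cp); exact: h.
exists (U' `&` P^°); split.
- exact/openI/open_interior.
- by [].
- by move=> y [/U'U].
- move=> j y; rewrite ltnS leq_eqVlt => /predU1P[->|jk] [U'y' Py].
    exact: interior_subset Py.
  exact: nz.
Qed.

(** * Constant osculating spaces and affine subspaces *)

Section Flat.
Variables (k : nat) (U : set 'rV[R]_2).
Hypotheses (oU : open U) (UU0 : U `<=` U0).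
Hypothesis nz : forall j y, (j < k)%N -> U y -> xi_perp G j y != 0.
Hypothesis z0 : forall y, U y -> xi_perp G k y = 0.

Lemma smooth_perp_osculating w : smooth_on U (fun y => perp_proj (osculating G k y) w) /\
  O U k (fun y => w - perp_proj (osculating G k y) w).
Proof.
exact: (csection_perp (f := fun=> w) I_cs oU (fun i _ => smooth_sub UU0 (smooth_xi i)) nz (@smooth_cst _ _ _ U w)).
Qed.

Let oscS y : U y -> osculating G k.+1 y = osculating G k y.
Proof. by move=> Uy; rewrite /osculating complex_flagS_perp // -/(xi_perp G k y) z0 // /cspan mul0mx !addv0. Qed.

(* Derivatives of sections of the osculating bundle are sections again, so the
   component of a fixed vector orthogonal to the bundle is parallel. *)
Lemma derive_perp_osculating w v y : U y -> 'D_v (fun x => perp_proj (osculating G k x) w) y = 0.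
Proof.
move=> Uy; have [sr Or] := smooth_perp_osculating w; set r := fun x => perp_proj _ w in sr Or *.
have dr x : U x -> differentiable r x by move=> Ux; exact: smooth_diff sr Ux.
(* As [w] is constant, this is up to sign the derivative of a section; the order it gains is lost
   again by [oscS]. *)
have mem : 'D_v r y \in osculating G k y.
  rewrite -oscS //; have /csection_mem-/(_ I_cs y Uy) := csection_D oU UU0 v Or.
  have -> : 'D_v (fun x => w - r x) y = - 'D_v r y.
    rewrite (@deriveB _ _ _ (fun=> w) r); [|exact: derivable_cst|exact/diff_derivable/dr].
    by rewrite (derive_cst w) sub0r.
  by rewrite memvN.
apply: (orth_mem0 mem).
have rO x f : U x -> O U k f -> dot (r x) (f x) = 0.
  move=> Ux Of; apply: (perp_proj_orth (V := osculating G k x)).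
  exact: (csection_mem I_cs Of).
(* In the derivative of [dot r f = 0] the term containing ['D_v f] drops out, because ['D_v f] stays
   in the osculating space. *)
have DrO f : O U k f -> smooth_on U f -> dot ('D_v r y) (f y) = 0.
  move=> Of sf; have := derive_dot v (dr y Uy) (smooth_diff sf Uy).
  rewrite (@derive_open_ext _ _ _ U (fun x => dot (r x) (f x)) (fun=> 0) y v oU Uy); last first.
    by move=> x Ux; exact: rO.
  rewrite (derive_cst 0) => /esym; rewrite [X in _ + X](_ : _ = 0) ?addr0 //.
  apply: (perp_proj_orth (V := osculating G k y)); rewrite -oscS //.
  exact: (csection_mem I_cs (csection_D oU UU0 v Of)).
apply: orth_complex_flag => i ik; split.
  by apply: (DrO (z i)); [exact: csection_gen | exact/(smooth_sub UU0)/smooth_xi].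
apply: (DrO (fun x => z i x *m I)); first exact/csection_I/csection_gen.
by apply: smooth_mulmx => //; exact/(smooth_sub UU0)/smooth_xi.
Qed.

(** As 2 k < n + 2, some w lies outside the osculating space. Its residual r is constant and nonzero
    on a ball and orthogonal to all tangent vectors there, so [G] moves within the hyperplane
    orthogonal to r. *)
Lemma flat_affine y0 : U y0 -> (0 < k)%N -> (k.*2 < n.+2)%N ->
  exists e : R, 0 < e /\ ball y0 e `<=` U /\
  exists V : {vspace E}, V != fullv /\ forall y, ball y0 e y -> G y - G y0 \in V.
Proof.
move=> Uy k0 kn; have /nbhs_ballP[e /= e0 eU] := open_nbhs_nbhs (conj oU Uy).
have [w wO] : exists w, w \notin osculating G k y0.
  apply: contrapT => /forallNP h.
  have : (fullv <= osculating G k y0)%VS.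
    by apply/subvP => w _; apply/negPn/negP; exact: h.
  move/dimvS; rewrite dimvf /dim /= mul1n leqNgt; apply/negP; rewrite negbK.
  exact: leq_ltn_trans (dim_complex_flag _ _ _) kn.
have [sr _] := smooth_perp_osculating w; set r := fun x => perp_proj _ w in sr.
have r_const y : ball y0 e y -> r y = r y0.
  apply: derive0_ball => // x Bx; first exact: (smooth_diff sr (eU _ Bx)).
  by move=> v; apply: derive_perp_osculating; exact: eU.
pose L := (linfun (mulmxr (r y0)^T : {linear E -> 'M[R]_1})).
exists e; split=> //; split=> //; exists (lker L); split.
  apply: contraNneq wO => kf.
  have : r y0 \in lker L by rewrite kf memvf.
  rewrite memv_ker lfunE /= => /eqP/matrixP/(_ 0 0); rewrite [in RHS]mxE => /eqP.
  by rewrite -[_ 0 0]/(dot (r y0) (r y0)) dot_eq0 perp_proj_eq0.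
move=> y By; rewrite memv_ker lfunE /= mulmxBl subr_eq0; apply/eqP.
apply: (@derive0_ball _ _ _ (fun x => G x *m (r y0)^T) _ e) => // x Bx.
  by apply: differentiable_mulmx; exact: (smooth_diff sG (UU0 (eU _ Bx))).
move=> v; rewrite derive_mulmx; last exact: (smooth_diff sG (UU0 (eU _ Bx))).
apply/rowP => j; rewrite ord1 [RHS]mxE -[LHS]/(dot ('D_v G x) (r y0)) -(r_const x Bx) dotC.
apply: (perp_proj_orth (V := osculating G k x)).
have := csection_mem I_cs (csection_DG oU UU0 v) (eU _ Bx).
exact/subvP/complex_flag_le.
Qed.
End Flat.

(** For some k with 1 <= k <= h, the residuals of order below k are all nonzero at some point of U,
    but those of order below k + 1 are so at none. Near such a point eta_k vanishes identically and
    [flat_affine] applies. *)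
Lemma nonfull_affine h y0 U : open U -> U `<=` U0 -> U y0 -> n.+2 = h.+1.*2 ->
  (forall y, U y -> ~ (forall j, (j < h.+1)%N -> xi_perp G j y != 0)) ->
  exists U' a (V : {vspace E}), [/\ open U', U' !=set0, U' `<=` U, V != fullv &
    forall y, U' y -> G y - a \in V].
Proof.
move=> oU UU0 Uy nE bad.
pose P k := exists2 y, U y & forall j, (j < k)%N -> xi_perp G j y != 0.
have [k [k0 kh Pk nPk]] : exists k, [/\ (0 < k)%N, (k < h.+1)%N, P k & ~ P k.+1].
  apply: contrapT => no.
  have PS k : (k <= h)%N -> P k.+1.
    elim: k => [_|k IH kh]; last first.
      apply: contrapT => nP; apply: no; exists k.+1; split=> //; exact/IH/ltnW.
    exists y0 => // j; rewrite ltnS leqn0 => /eqP->.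
    rewrite /xi_perp /flag_perp perp_proj_id; first exact/xi0/UU0.
    by move=> v; rewrite memv0 => /eqP->; rewrite dot0r.
  by have [y Uy' hy] := PS h (leqnn h); exact: (bad y).
case: Pk => y1 Uy1 hy1.
have [U' [oU' U'y1 U'U nz]] := flag_perp_neq0_open oU UU0 Uy1 hy1.
have U'U0 : U' `<=` U0 by move=> y /U'U/UU0.
have z0 y : U' y -> xi_perp G k y = 0.
  move=> U'y; apply: contrapT => /eqP ne; apply: nPk; exists y; first exact: U'U.
  by move=> j; rewrite ltnS leq_eqVlt => /predU1P[->//|jk]; exact: nz.
have [|e [e0 [eU' [V [Vf hV]]]]] := flat_affine oU' U'U0 nz z0 U'y1 k0.
  by rewrite nE ltn_double.
exists (ball y1 e)^°, (G y1), V; split=> //.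
- exact: open_interior.
- by exists y1; apply: nbhsx_ballx.
- by move=> y /interior_subset/eU'/U'U.
- by move=> y /interior_subset/hV.
Qed.

End HolomorphicPatch.

(** * Rotations of complex lines *)

Definition cexp (R : realType) (N : nat) (I : 'M[R]_N) (theta : R) : 'M[R]_N :=
  cos theta *: 1%:M + sin theta *: I.

Section Rotation.
Context {R : realType} {N : nat} (I : 'M[R]_N).
Hypothesis I_cs : parallel_complex_structure I.

Lemma mul_cexp theta (v : 'rV[R]_N) :
  v *m cexp I theta = cos theta *: v + sin theta *: (v *m I).
Proof. by rewrite mulmxDr -!scalemxAr mulmx1. Qed.

Lemma cexpK theta (v : 'rV[R]_N) : v *m cexp I theta *m cexp I (- theta) = v.
Proof.
rewrite !mul_cexp !mulmxDl -!scalemxAl (mulII I_cs) cosN sinN.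
move: (v *m I) => w; apply/rowP => i; rewrite !mxE.
by rewrite -[RHS]mul1r -(cos2Dsin2 theta); ring.
Qed.

(** [rotates] gives the image of the first vector of an oriented orthonormal pair. With c = 1 / |e|,
    the pairs (c e, c e I) and (c e I, - c e) yield the images of e and e I. *)
Lemma rotates_cspan e theta (A : 'M[R]_N) : e != 0 ->
  rotates (cspan I e) e (e *m I) theta A ->
  forall v, v \in cspan I e -> v *m A = v *m cexp I theta.
Proof.
move=> e0 rA; have ee : 0 < dot e e by rewrite dot_gt0.
pose c := (Num.sqrt (dot e e))^-1.
have c0 : c != 0 by rewrite invr_eq0 sqrtr_eq0 -ltNge.
have cc : c * (c * dot e e) = 1.
  have s0 : Num.sqrt (dot e e) != 0 by rewrite sqrtr_eq0 -ltNge.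
  by rewrite -{1}(sqr_sqrtr (ltW ee)) /c; field.
have cee : 0 < c * dot e e * (c * dot e e).
  by rewrite -expr2 exprn_even_gt0 //= mulf_neq0 // gt_eqF.
have eI0 : dot e (e *m I) = 0 by exact: dotI0.
have eIe0 : dot (e *m I) e = 0 by rewrite dotC.
have eA : e *m A = e *m cexp I theta.
  have := rA (c *: e) (c *: (e *m I)).
  rewrite !memvZ ?cspan_stable ?mem_cspan // => /(_ isT isT) h.
  apply: (scalerI c0); rewrite !scalemxAl h; last 2 first.
  - by split; rewrite !dot_lin ?(dotII I_cs) ?eI0 ?mulr0.
  - by rewrite /same_orientation !dot_lin (dotII I_cs) eI0 !mulr0 mul0r subr0.
  by rewrite mul_cexp -scalemxAl.
have eIA : (e *m I) *m A = (e *m I) *m cexp I theta.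
  have := rA (c *: (e *m I)) (- (c *: e)).
  rewrite memvN !memvZ ?cspan_stable ?mem_cspan // => /(_ isT isT) h.
  apply: (scalerI c0); rewrite [LHS]scalemxAl [RHS]scalemxAl h; last 2 first.
  - by split; rewrite !dot_lin ?(dotII I_cs) ?eIe0 ?mulr0 ?oppr0 ?mulr0 ?mulrN ?opprK ?oppr0.
  - rewrite /same_orientation !dot_lin (dotII I_cs) eI0 eIe0 !mulr0 oppr0 mul0r sub0r.
    by rewrite mulNr opprK.
  by rewrite mul_cexp; congr (_ + _ *: _); rewrite -scalemxAl (mulII I_cs) scalerN.
move=> v /(cspanP I)[a [b ->]].
by rewrite !mulmxDl -![(_ *: _) *m A]scalemxAl -![(_ *: _) *m cexp _ _]scalemxAl eA eIA.
Qed.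

(** Peel off the last complex line: it is orthogonal to the smaller flag, so the remaining summand
    is still orthogonal to the flag of order 2. *)
Lemma flag_rotation (z : nat -> 'rV[R]_N) theta (A : 'M[R]_N) k :
  (forall j, (2 <= j < k)%N -> flag_perp I z j != 0 /\
     rotates (cspan I (flag_perp I z j)) (flag_perp I z j) (flag_perp I z j *m I) theta A) ->
  forall v, v \in complex_flag I z k -> orth (complex_flag I z 2) v -> v *m A = v *m cexp I theta.
Proof.
elim: k => [|k IH] rot v; first by rewrite memv0 => /eqP-> _; rewrite !mul0mx.
have rotS j : (2 <= j < k)%N -> (2 <= j < k.+1)%N by move=> /andP[-> /ltnW].
have {}IH := IH (fun j jk => rot j (rotS j jk)).
(* For k < 2 the vector lies in the flag of order 2 and is orthogonal to it, hence is 0. *)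
have [k2|k2] := leqP 2 k; last first.
  move=> vk vo; have l : (complex_flag I z k.+1 <= complex_flag I z 2)%VS by exact: complex_flag_le.
  by rewrite (orth_mem0 (subvP l _ vk) vo) !mul0mx.
rewrite complex_flagS_perp // => /memv_addP[a ak [b bk ->]] vo.
have [|e0 rk] := rot k; first by rewrite k2 ltnSn.
have bo : orth (complex_flag I z k) b.
  move/cspanP: bk => [c [d ->]]; apply: orthD; apply: orthZ; first exact: flag_perp_orth.
  exact/orthI/flag_perp_orth/complex_flag_stable.
rewrite !mulmxDl (rotates_cspan e0 rk bk) (IH a) //.
rewrite -(addrK b a); apply: orthB => //; apply: orthS bo; exact: complex_flag_le.
Qed.
End Rotation.

Lemma derive_dir (R : realType) (V W : normedModType R) (f : V -> W) x (a b : R) u v :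
  differentiable f x -> 'D_(a *: u + b *: v) f x = a *: 'D_u f x + b *: 'D_v f x.
Proof. by move=> df; rewrite !deriveE // linearD !linearZ. Qed.

(** * Charts *)

(* [coord] is shadowed by the coordinates of vector.v. *)
Local Notation coord := Defs.coord.

Section Charts.
Context {R : realType} {L : oriented_riemannian_surface R}.
Implicit Types (p q : L) (y u : 'rV[R]_2).

Definition trans p q := transition (chart_at p) (chart_at q).
Definition trans_dom p q := transition_dom (chart_at p) (chart_at q).

Lemma open_cod p : open (cod_at p).
Proof. exact: chart_cod_open. Qed.

Lemma cod_coord p : cod_at p (coord p).
Proof. by exists p => //; exact: chart_at_dom. Qed.

Lemma chart_map_cod p q : chart_dom (chart_at p) q -> cod_at p (chart_map (chart_at p) q).
Proof. by exists q. Qed.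

Lemma chart_inv_dom p y : cod_at p y -> chart_dom (chart_at p) (chart_inv (chart_at p) y).
Proof. by move=> [q dq <-]; rewrite chart_mapK. Qed.

Lemma chart_invK p y : cod_at p y -> chart_map (chart_at p) (chart_inv (chart_at p) y) = y.
Proof. by move=> [q dq <-]; rewrite chart_mapK. Qed.

Lemma chart_inv_coord p : chart_inv (chart_at p) (coord p) = p.
Proof. by rewrite chart_mapK //; exact: chart_at_dom. Qed.

Lemma open_chart_inv p (U : set 'rV[R]_2) (W : set L) : open U -> U `<=` cod_at p ->
  open W -> open (U `&` chart_inv (chart_at p) @^-1` W).
Proof.
move=> oU Uc oW; rewrite openE => y [Uy Wy]; apply: filterI.
  exact: (open_nbhs_nbhs (conj oU Uy)).
have /= := chart_inv_continuous (Uc _ Uy); apply.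
exact: (open_nbhs_nbhs (conj oW Wy)).
Qed.

Lemma open_chart_map p (U : set 'rV[R]_2) : open U ->
  open (chart_dom (chart_at p) `&` chart_map (chart_at p) @^-1` U).
Proof.
move=> oU; rewrite openE => q [dq Uq]; apply: filterI.
  exact: (open_nbhs_nbhs (conj (chart_dom_open _) dq)).
have /= := chart_map_continuous dq; apply.
exact: (open_nbhs_nbhs (conj oU Uq)).
Qed.

Lemma open_trans_dom p q : open (trans_dom p q).
Proof.
apply: open_chart_inv => //; first exact: open_cod.
exact: chart_dom_open.
Qed.

Lemma trans_cod p q y : trans_dom p q y -> cod_at q (trans p q y).
Proof. by move=> [_ dy]; exact: chart_map_cod. Qed.

(** Pointwise notions are read in the chart of the point itself; this is the passage from an
    arbitrary chart to that one. *)
Lemma trans_dom_self p y (q := chart_inv (chart_at p) y) : cod_at p y ->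
  trans_dom p q y /\ trans p q y = coord q.
Proof. by move=> cy; split=> //; split=> //; exact: chart_at_dom. Qed.

Lemma smooth_trans p q : smooth_on (trans_dom p q) (trans p q).
Proof. exact: transition_smooth. Qed.

Lemma in_chart_trans (T : Type) p q (f : L -> T) y : trans_dom p q y ->
  in_chart p f y = in_chart q f (trans p q y).
Proof. by move=> [cy dy]; rewrite /in_chart /trans /transition /= chart_mapK. Qed.

Lemma derive_in_chart (W : normedModType R) p q (f : L -> W) y u : trans_dom p q y ->
  differentiable (in_chart q f) (trans p q y) ->
  'D_u (in_chart p f) y = 'D_('D_u (trans p q) y) (in_chart q f) (trans p q y).
Proof.
move=> dy df; rewrite -derive_comp //; last exact: (smooth_diff (@smooth_trans p q)).
apply: (@derive_open_ext _ _ _ (trans_dom p q)) => //; first exact: open_trans_dom.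
by move=> x; exact: in_chart_trans.
Qed.

Lemma mx2P (A B : 'M[R]_2) : A 0 0 = B 0 0 -> A 0 1 = B 0 1 -> A 1 0 = B 1 0 ->
  A 1 1 = B 1 1 -> A = B.
Proof.
have ord2 (i : 'I_2) : i = 0 \/ i = 1.
  by case: i => [[|[|m]] hm] //; [left | right]; exact: val_inj.
move=> h00 h01 h10 h11; apply/matrixP => i j.
by case: (ord2 i) => ->; case: (ord2 j) => ->.
Qed.

(* The matrix in the definition of cplxJ. *)
Definition eps2 : 'M[R]_2 := \matrix_(i < 2, j < 2) (j%:R - i%:R).

Lemma lift01 : lift ord0 ord0 = 1 :> 'I_2.
Proof. exact: val_inj. Qed.

Lemma det_mx22 (B : 'M[R]_2) : \det B = B 0 0 * B 1 1 - B 0 1 * B 1 0.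
Proof.
have l0 : lift 0 0 = 1 :> 'I_2 by exact: val_inj.
have l1 : lift 1 0 = 0 :> 'I_2 by exact: val_inj.
rewrite (expand_det_row _ 0) big_ord_recl big_ord1 lift01 /cofactor !det_mx11 !mxE !l0 !l1.
by rewrite /= expr0 expr1 mul1r mulN1r mulrN.
Qed.

Lemma tr_eps2_mul (B : 'M[R]_2) : B^T *m eps2 *m B = \det B *: eps2.
Proof.
rewrite det_mx22.
by apply: mx2P; rewrite !mxE !big_ord_recl !big_ord0 !lift01 !mxE
  !big_ord_recl !big_ord0 !lift01 !mxE /=; ring.
Qed.

(** With B the Jacobian, B^T eps B = det B eps, while the normalizing square root contributes the
    inverse of |det B|. They cancel because the atlas is oriented. *)
Lemma cplxJ_trans p q y u : trans_dom p q y ->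
  'D_(cplxJ p y u) (trans p q) y = cplxJ q (trans p q y) ('D_u (trans p q) y).
Proof.
move=> dy; set t := trans p q; have dt : differentiable t y.
  exact: (smooth_diff (@smooth_trans p q)).
rewrite !derivemxE //; set B := 'J t y.
have B0 : 0 < \det B by exact: transition_oriented dy.
have gE : gram p y = B *m gram q (t y) *m B^T by exact: gram_transition dy.
rewrite /cplxJ gE !det_mulmx det_tr -/eps2; set A := gram q (t y).
have -> : \det B * \det A * \det B = (\det B) ^+ 2 * \det A by ring.
rewrite sqrtrM ?sqr_ge0 // sqrtr_sqr gtr0_norm // invfM -!scalemxAl.
rewrite -!mulmxA (mulmxA _ eps2 B) tr_eps2_mul -!scalemxAr scalerA.
congr (_ *: _); first by rewrite mulrC mulrA divff ?mul1r // gt_eqF.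
Qed.

End Charts.

Lemma csection_comp (R : realType) (m m' N : nat) (I : 'M[R]_N) (z : nat -> 'rV[R]_m' -> 'rV[R]_N)
    U U' k f (t : 'rV[R]_m -> 'rV[R]_m') : open U -> (forall y, U y -> U' (t y)) ->
  smooth_on U t -> csection I z U' k f -> csection I (fun i => z i \o t) U k (f \o t).
Proof.
move=> oU UU st; elim=> [i ik||{}f _ h|{}f g _ hf _ hg|a {}f sa _ h|{}f g e _ h].
- exact: (@csection_gen _ _ _ I (fun i => z i \o t)).
- exact: csection_zero.
- exact: (csection_I h).
- exact: (csection_add hf hg).
- exact: (csection_scale (smooth_comp oU UU st sa) h).
- by apply: csection_ext h => y Uy; exact: (e _ (UU _ Uy)).
Qed.

(** For odd N the square of the real number [\det I] would be -1. *)
Lemma complex_structure_even (R : realType) (N : nat) (I : 'M[R]_N) :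
  parallel_complex_structure I -> ~~ odd N.
Proof.
move=> [II _]; apply/negP => oN; have := congr1 determinant II.
rewrite det_mulmx -[- _ in RHS]scaleN1r scalemx1 det_scalar -signr_odd oN expr1 => h.
by have := sqr_ge0 (\det I); rewrite expr2 h oppr_ge0 ler10.
Qed.

(** * Holomorphic surfaces: change of chart and density of nondegenerate points *)

Section HolomorphicSurface.
Context {R : realType} {L : oriented_riemannian_surface R} {n : nat}.
Variables (g : L -> 'rV[R]_n.+2) (I : 'M[R]_n.+2).
Hypothesis g_isom : isometric_immersion g.
Hypothesis I_cs : parallel_complex_structure I.
Hypothesis g_hol : holomorphic g I.
Implicit Types (p q : L) (y u v : 'rV[R]_2).
Notation G p := (in_chart p g).
Notation d1 := (delta_mx 0 0 : 'rV[R]_2).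

Lemma smooth_G p : smooth_on (cod_at p) (G p).
Proof. by case: g_isom => h _; exact: h. Qed.

(** [holomorphic] speaks of each point in its own chart; the chain rule and [cplxJ_trans] carry it
    to all points of the chart at p. *)
Lemma holomorphic_chart p y u : cod_at p y ->
  'D_(cplxJ p y u) (G p) y = 'D_u (G p) y *m I.
Proof.
move=> cy; have [dy ty] := trans_dom_self cy; set q := chart_inv _ y in dy ty.
have dG : differentiable (G q) (trans p q y).
  exact: (smooth_diff (smooth_G q) (trans_cod dy)).
rewrite !(derive_in_chart _ dy dG) cplxJ_trans // ty; exact: g_hol.
Qed.

Lemma xi0_neq0 p y : cod_at p y -> xi (G p) 0 y != 0.
Proof.
case: g_isom => _ gm cy; rewrite -dot_gt0 /xi /= gm //; apply: gram_pos => //.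
by apply/eqP => /rowP/(_ 0); rewrite !mxE /= => /eqP; rewrite oner_eq0.
Qed.

(** J sends the first coordinate vector to one with nonzero second component b, so holomorphy can be
    solved for the second partial derivative. *)
Lemma derive_span p y u : cod_at p y -> 'D_u (G p) y \in cspan I (xi (G p) 0 y).
Proof.
move=> cy; have dG : differentiable (G p) y by exact: (smooth_diff (smooth_G p)).
set e := xi (G p) 0 y; set d2 := 'D_(delta_mx 0 1) (G p) y.
have DE v : 'D_v (G p) y = v 0 0 *: e + v 0 1 *: d2.
  by rewrite derive_rowE // big_ord_recl big_ord1 lift01.
have := holomorphic_chart d1 cy; rewrite -[X in _ = X *m I]/e DE.
set a := _ 0 0; set b := cplxJ _ _ _ 0 1 => eI.
have b0 : b != 0.
  apply/eqP => b0; rewrite b0 scale0r addr0 in eI.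
  have e0 : e != 0 by exact: xi0_neq0.
  have := dotI0 I_cs e; rewrite -eI dotZr => /eqP; rewrite mulf_eq0 dot_eq0 (negPf e0) orbF.
  move=> /eqP a0; have := dotII I_cs e e; rewrite -eI a0 scale0r dot0l => /esym/eqP.
  by rewrite dot_eq0 (negPf e0).
have d2m : d2 \in cspan I e.
  have -> : d2 = b^-1 *: (e *m I - a *: e).
    by rewrite -eI (addrC (a *: e)) addrK scalerA mulVf // scale1r.
  apply: memvZ; apply: memvB; last exact/memvZ/mem_cspan.
  exact/cspan_stable/mem_cspan.
rewrite (DE u).
apply: memvD; apply: memvZ.
  exact: mem_cspan.
exact: d2m.
Qed.

(* The complex Wronskian of the curve does not vanish at q. *)
Definition nondegenerate h q := forall j, (j < h.+1)%N -> xi_perp I (G q) j (coord q) != 0.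

(** By the chain rule a derivative in one chart is a combination, with smooth coefficients, of
    derivatives of no higher order in the other. [csection_Dxi] brings the latter, taken in
    arbitrary directions, back to the [xi]. *)
Lemma xi_trans p q k :
  csection I (fun i => xi (G q) i \o trans p q) (trans_dom p q) k.+1 (xi (G p) k).
Proof.
have oV := @open_trans_dom _ L p q; have oC := @open_cod _ L q.
have st := @smooth_trans _ L p q.
have tC : forall y, trans_dom p q y -> cod_at q (trans p q y) by exact: trans_cod.
have sz i : smooth_on (trans_dom p q) (xi (G q) i \o trans p q).
  apply: (smooth_comp_row oV oC tC st); exact: smooth_xi (smooth_G q) i.
have Dcomp (f : 'rV[R]_2 -> 'rV[R]_n.+2) v l : smooth_on (cod_at q) f ->
    (forall w, csection I (xi (G q)) (cod_at q) l ('D_w f)) ->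
    csection I (fun i => xi (G q) i \o trans p q) (trans_dom p q) l ('D_v (f \o trans p q)).
  move=> sf Of; apply: (@csection_ext _ _ _ _ _ _ _ (fun y =>
    \sum_i 'D_v (trans p q) y 0 i *: ('D_(delta_mx 0 i) f \o trans p q) y)) => [y dy|].
    rewrite derive_comp; [|exact: smooth_diff st dy|exact: smooth_diff sf (tC y dy)].
    by rewrite [RHS]derive_rowE //; exact: smooth_diff sf (tC y dy).
  apply: csection_sum => i; apply: csection_scale; last exact: (csection_comp oV tC st (Of _)).
  exact: ((smooth_row _ oV).1 (smooth_derive v st) i).
elim: k => [|k IH].
  apply: (@csection_ext _ _ _ _ _ _ _ ('D_d1 (G q \o trans p q))) => [y dy|].
    apply: (@derive_open_ext _ _ _ (trans_dom p q)) => // x dx.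
    by rewrite (in_chart_trans _ dx).
  apply: Dcomp; first exact: smooth_G.
  exact: (csection_DG I_cs (smooth_G q) (@xi0_neq0 q) (@derive_span q) oC (@subset_refl _ _)).
apply: (csection_derive oV (leqnSn k.+1) (fun i _ => sz i)) IH => i ik.
apply: Dcomp; first exact: smooth_xi (smooth_G q) i.
move=> w; apply: (@csection_le _ _ _ _ _ _ i.+2) => //.
exact: (csection_Dxi I_cs oC (smooth_G q) (@xi0_neq0 q) (@derive_span q) oC (@subset_refl _ _)).
Qed.

(** [xi_trans] embeds the osculating space of the chart at p in that of the point's own chart. The
    former has full dimension, hence so has the latter. *)
Lemma nondegenerate_chart h p y : n.+2 = h.+1.*2 -> cod_at p y ->
  (forall j, (j < h.+1)%N -> xi_perp I (G p) j y != 0) ->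
  nondegenerate h (chart_inv (chart_at p) y).
Proof.
move=> nE cy nz; have [dy ty] := trans_dom_self cy; set q := chart_inv _ y in dy ty *.
have dp := (dim_complex_flag_full I_cs (fun i => xi (G p) i y) h.+1).2 nz.
apply/(dim_complex_flag_full I_cs (fun i => xi (G q) i (coord q)) h.+1).
apply/eqP; rewrite eqn_leq; apply/andP; split; first exact: dim_complex_flag.
apply: leq_trans (eq_leq (esym dp)) _.
apply: dimvS; apply: (@complex_flag_sub _ _ I); first exact: (@complex_flag_stable _ _ I I_cs).
move=> i ih; have := csection_mem I_cs (@xi_trans p q i) dy; rewrite /= ty => hm.
exact: (subvP (complex_flag_le I (fun i => xi (G q) i (coord q)) ih) _ hm).
Qed.

Hypothesis g_subst : substantial g.

Lemma nondegenerate_dense h (W : set L) : n.+2 = h.+1.*2 -> open W -> W !=set0 ->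
  exists2 q, W q & nondegenerate h q.
Proof.
move=> nE oW [p Wp]; apply: contrapT => no.
pose U := cod_at p `&` chart_inv (chart_at p) @^-1` W.
have oU : open U.
  by apply: open_chart_inv => //; exact: open_cod.
have Up : U (coord p) by split; [exact: cod_coord | rewrite /= chart_inv_coord].
have bad y : U y -> ~ (forall j, (j < h.+1)%N -> xi_perp I (G p) j y != 0).
  move=> [cy Wy] nz; apply: no; exists (chart_inv (chart_at p) y); first exact: Wy.
  exact: nondegenerate_chart nE cy nz.
have UC : U `<=` cod_at p by move=> y [].
have [U' [a [V [oU' [y U'y] U'U Vf hV]]]] :=
  nonfull_affine I_cs (@open_cod _ L p) (smooth_G p) (@xi0_neq0 p) (@derive_span p)
    oU UC Up nE bad.
have [cy _] := U'U _ U'y.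
apply: (g_subst (open_chart_map p oU')).
  exists (chart_inv (chart_at p) y); split; first exact: chart_inv_dom.
  by rewrite /= chart_invK.
exists a, V; split=> // q [dq U'q]; have := hV _ U'q.
by rewrite /in_chart /= chart_mapK.
Qed.
End HolomorphicSurface.

(** * Real Gram-Schmidt for plane fields *)

Section LineProjection.
Context {R : realType} {N : nat}.
Implicit Types (V : {vspace 'rV[R]_N}) (a b w : 'rV[R]_N).

Definition lproj a w : 'rV[R]_N := (dot w a / dot a a) *: a.

Lemma perp_proj_addl V b w : let r := perp_proj V w in
  perp_proj (V + <[b]>)%VS w = r - lproj (perp_proj V b) r.
Proof.
move=> r; set b' := perp_proj V b.
have ro : orth V r by exact: perp_proj_orth.
have bo : orth V b' by exact: perp_proj_orth.
have bm : b - b' \in V by exact: perp_proj_mem.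
apply: perp_projE.
  apply: orth_addv; first exact/orthB/orthZ.
  apply: orth_line; rewrite -(subrK b' b) dotDr (orthB ro (orthZ _ bo) bm) add0r.
  rewrite /lproj dotBl dotZl; have [->|b0] := eqVneq b' 0; first by rewrite !dot0r mulr0 subr0.
  by rewrite divfK ?subrr // dot_eq0.
rewrite opprB addrCA addrC memvD //; first by rewrite memv_addl // perp_proj_mem.
apply: memvZ; rewrite -(subKr b b') memvB //; first by rewrite memv_addr // memv_line.
by rewrite memv_addl.
Qed.

Lemma perp_proj_line a w : perp_proj <[a]>%VS w = w - lproj a w.
Proof.
have e0 u : perp_proj 0%VS u = u.
  by apply: perp_proj_id => v; rewrite memv0 => /eqP->; rewrite dot0r.
by have := perp_proj_addl 0 a w; rewrite /= add0v !e0.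
Qed.

Lemma smooth_lproj (V : normedModType R) U (a w : V -> 'rV[R]_N) : open U ->
  smooth_on U a -> smooth_on U w -> (forall y, U y -> a y != 0) ->
  smooth_on U (fun y => lproj (a y) (w y)).
Proof.
move=> oU sa sw a0; apply: smooth_scale => //; apply: smooth_mul => //.
  exact: smooth_dot.
apply: smooth_inv => // [y Uy|]; first by rewrite dot_eq0 a0.
exact: smooth_dot.
Qed.

(** Meant for [N1bar], which is given by real frames, so that Gram-Schmidt is real here; rank 2
    keeps both denominators nonzero. *)
Lemma smooth_perp_plane (V : normedModType R) U (e1 e2 w : V -> 'rV[R]_N) : open U ->
  smooth_on U e1 -> smooth_on U e2 -> smooth_on U w ->
  (forall y, U y -> \dim <<[:: e1 y; e2 y]>>%VS = 2) ->
  smooth_on U (fun y => perp_proj <<[:: e1 y; e2 y]>>%VS (w y)).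
Proof.
move=> oU s1 s2 sw d2.
have sE y : <<[:: e1 y; e2 y]>>%VS = (<[e1 y]> + <[e2 y]>)%VS.
  by rewrite span_cons span_seq1.
have n1 y : U y -> e1 y != 0.
  move=> Uy; apply/eqP => e0; have := d2 y Uy; rewrite sE e0 add0v dim_vline.
  by case: (_ != _).
pose f y := perp_proj <[e1 y]>%VS (e2 y).
have n2 y : U y -> f y != 0.
  move=> Uy; rewrite perp_proj_eq0; apply/negP => h; have := d2 y Uy.
  have -> : <<[:: e1 y; e2 y]>>%VS = <[e1 y]>%VS.
    by rewrite sE; apply/addv_idPl; rewrite -memvE.
  by rewrite dim_vline; case: (_ != _).
have sp (w' : V -> 'rV[R]_N) : smooth_on U w' -> smooth_on U (fun y => perp_proj <[e1 y]>%VS (w' y)).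
  move=> sw'; apply: (@smooth_ext _ _ _ _ (fun y => w' y - lproj (e1 y) (w' y))) => // [y _|].
    by rewrite perp_proj_line.
  by apply: smooth_sub_row => //; exact: smooth_lproj.
apply: (@smooth_ext _ _ _ _ (fun y => perp_proj <[e1 y]>%VS (w y) -
   lproj (f y) (perp_proj <[e1 y]>%VS (w y)))) => // [y _|].
  by rewrite sE perp_proj_addl.
by apply: smooth_sub_row; [|exact: sp|apply: smooth_lproj => //; exact: sp].
Qed.
End LineProjection.

(** * The rotation field on Lambda *)

Section RotationField.
Context {R : realType} {L : oriented_riemannian_surface R} {n : nat}.
Variables (g : L -> 'rV[R]_n.+2) (I : 'M[R]_n.+2).
Hypothesis g_isom : isometric_immersion g.
Hypothesis I_cs : parallel_complex_structure I.
Hypothesis g_hol : holomorphic g I.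
Hypothesis g_subst : substantial g.
Variable N1bar : L -> {vspace 'rV[R]_n.+2}.
Hypothesis N1barP : smooth_extension_of_N1 g N1bar.
Variable h : nat.
Hypothesis nE : n.+2 = h.+1.*2.
Hypothesis h2 : (2 <= h)%N.
Implicit Types (p q : L) (y u : 'rV[R]_2) (v : 'rV[R]_n.+2).
Notation G p := (in_chart p g).
Notation d1 := (delta_mx 0 0 : 'rV[R]_2).
Notation nondegenerate := (nondegenerate g I h).

Let sG p := smooth_G g_isom p.
Let x0 p := @xi0_neq0 _ _ _ _ g_isom p.
Let sp p := @derive_span _ _ _ _ _ g_isom I_cs g_hol p.
Let GJ p y u := @holomorphic_chart _ _ _ _ _ g_isom g_hol p y u.
Let oC p := @open_cod _ L p.

Lemma tangent_in_chart p y : cod_at p y ->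
  tangent_space g (chart_inv (chart_at p) y) = cspan I (xi (G p) 0 y).
Proof.
move=> cy; have [dy ty] := trans_dom_self cy; set q := chart_inv _ y in dy ty *.
have cq : cod_at q (coord q) by exact: cod_coord.
rewrite /tangent_space (tangent_atE (@sp q) (@GJ q) cq); apply/esym/eqP.
have dG : differentiable (G q) (trans p q y).
  exact: (smooth_diff (sG q) (trans_cod dy)).
rewrite eqEdim; apply/andP; split; last first.
  exact/eq_leq/(etrans (dim_cspan I_cs (x0 cq)) (esym (dim_cspan I_cs (x0 cy)))).
apply: cspan_sub; first exact: cspan_stable.
have := derive_in_chart d1 dy dG; rewrite ty => e; rewrite /xi /= e.
exact: sp.
Qed.

Lemma normal_spaceE k q : (0 < k)%N ->
  Defs.normal_space g k q = cspan I (xi_perp I (G q) k (coord q)).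
Proof.
exact: (nspace_atE I_cs (@oC q) (sG q) (@x0 q) (@sp q) (@GJ q) (cod_coord q)).
Qed.

Lemma nondegenerate_generic q : nondegenerate q -> generic g q.
Proof.
move=> gq s s1 sn; rewrite normal_spaceE // dim_cspan // gq //.
by rewrite ltnS -leq_double; apply: leq_trans sn _; move: nE; rewrite doubleS => -[->].
Qed.

(** [N1bar] is tied to N_1 where alpha is nonzero. Here it is nonzero: on the first coordinate
    vector, alpha projects to eta_1. *)
Lemma nondegenerate_N1bar q : nondegenerate q -> N1bar q = cspan I (xi_perp I (G q) 1 (coord q)).
Proof.
move=> gq; case: N1barP => _ /(_ q) ->; first by rewrite normal_spaceE.
exists d1, d1; have n1 := gq 1%N (ltnW h2); apply: contraNneq n1 => a0.
rewrite -(perp_nabla_d1 I_cs (@oC q) (sG q) (@x0 q) (@sp q) (@GJ q) 0 (cod_coord q)).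
rewrite -[nabla_iter _ _ _ _]/(alpha g q d1 d1) a0 perp_proj0 //; exact: mem0v.
Qed.

Lemma nondegenerate_Lambda q v : nondegenerate q -> Lambda g N1bar q v ->
  orth (osculating I (G q) 2 (coord q)) v.
Proof.
move=> gq [vT vN].
rewrite (osculating2 I_cs (@oC q) (sG q) (@x0 q) (@sp q) (@GJ q) (cod_coord q)).
by apply: orth_addv => //; rewrite -[nspace_at _ _ _]/(Defs.normal_space g 1 q) normal_spaceE // -nondegenerate_N1bar.
Qed.

Lemma nondegenerate_rotation theta A q v : rotation_field g N1bar theta A -> nondegenerate q ->
  Lambda g N1bar q v -> v *m A q = v *m cexp I theta.
Proof.
move=> [_ _ rot] gq Lv.
apply: (@flag_rotation _ _ I I_cs (fun i => xi (G q) i (coord q)) theta (A q) h.+1); last exact: nondegenerate_Lambda.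
- move=> j /andP[j2 jh]; split; first exact: gq.
  have sd : smooth_near (coord q) (fun _ : 'rV[R]_2 => d1).
    by exists (cod_at q); split; [exact: oC|exact: cod_coord|exact: smooth_cst].
  have d0 : d1 != 0 by apply/eqP => /rowP/(_ 0); rewrite !mxE /= => /eqP; rewrite oner_eq0.
  have jn : (j.*2 <= n)%N.
    by move: jh; rewrite ltnS -leq_double => jh; apply: leq_trans jh _; move: nE; rewrite doubleS => -[->].
  have := rot q (nondegenerate_generic gq) j j2 jn _ sd d0; cbv zeta.
  have j0 : (0 < j)%N by exact: ltnW.
  rewrite normal_spaceE //.
  rewrite (higher_form_d1 I_cs (@oC q) (sG q) (@x0 q) (@sp q) (@GJ q) (cod_coord q)) //.
  rewrite (higher_form_I I_cs (@oC q) (sG q) (@x0 q) (@sp q) (@GJ q) (cod_coord q)) //.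
    by move=> i /negPf->.
  by move=> x cx; exact: GJ.
(* The h + 1 orthogonal complex lines fill the ambient space, so every vector lies in the flag. *)
- have full : \dim (complex_flag I (fun i => xi (G q) i (coord q)) h.+1) = h.+1.*2.
    exact/(dim_complex_flag_full I_cs).
  suff -> : complex_flag I (fun i => xi (G q) i (coord q)) h.+1 = fullv by exact: memvf.
  by apply/eqP; rewrite eqEdim subvf full dimvf /dim /= mul1n nE.
Qed.

Lemma dense_zero (W : normedModType R) p U (f : 'rV[R]_2 -> W) : open U -> U `<=` cod_at p ->
  (forall y, U y -> {for y, continuous f}) ->
  (forall y, U y -> nondegenerate (chart_inv (chart_at p) y) -> f y = 0) ->
  forall y, U y -> f y = 0.
Proof.
move=> oU UC cf f0 y Uy; apply: contrapT => /eqP fy.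
have nP : nbhs y [set x | f x != 0] by exact: (cvgr_neq0 _ (cf y Uy)).
pose U' := U `&` [set x | f x != 0]^°.
have oU' : open U' by apply: openI => //; exact: open_interior.
have U'y : U' y by split.
have [|q [dq [Uq /interior_subset Wq]] gq] :=
  nondegenerate_dense g_isom I_cs g_hol g_subst nE (open_chart_map p oU').
  exists (chart_inv (chart_at p) y); split; first exact/chart_inv_dom/UC.
  by rewrite /= chart_invK //; exact: UC.
have fz : f (chart_map (chart_at p) q) = 0.
  apply: f0; first exact: Uq.
  by rewrite (chart_mapK dq).
by move: Wq => /eqP; rewrite fz.
Qed.

Lemma nondegenerate_N1bar_orth q v : nondegenerate q -> v \in N1bar q -> orth (tangent_space g q) v.
Proof.
move=> gq; rewrite nondegenerate_N1bar // /tangent_space.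
rewrite (tangent_osculating (@sp q) (@GJ q) (cod_coord q)) => /cspanP[a [b ->]].
apply: orthD; apply: orthZ; first exact: xi_perp_orth.
by apply: (orthI I_cs); [exact: osculating_stable | exact: xi_perp_orth].
Qed.

(** At nondegenerate points [N1bar] is N_1, hence normal. The products of a smooth section with xi_0
    and xi_0 I thus vanish on a dense set, and everywhere by continuity. *)
Lemma N1bar_section_orth p U e : open U -> U `<=` cod_at p -> smooth_on U e ->
  (forall y, U y -> e y \in in_chart p N1bar y) ->
  forall y, U y -> orth (cspan I (xi (G p) 0 y)) (e y).
Proof.
move=> oU UC se eN.
have sx : smooth_on U (xi (G p) 0) by exact: (smooth_sub UC (smooth_xi (sG p) 0)).
have nondegenerate_orth y : U y -> nondegenerate (chart_inv (chart_at p) y) ->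
    orth (cspan I (xi (G p) 0 y)) (e y).
  move=> Uy gq; rewrite -tangent_in_chart; last exact: UC.
  by apply: nondegenerate_N1bar_orth => //; exact: eN.
have zero f : smooth_on U f ->
    (forall y, f y \in cspan I (xi (G p) 0 y)) ->
    forall y, U y -> dot (e y) (f y) = 0.
  move=> sf fT; apply: (@dense_zero _ p U (fun y => dot (e y) (f y))) => // y Uy.
    exact: (smooth_continuous (smooth_dot oU se sf) Uy).
  by move=> gq; exact: (nondegenerate_orth y Uy gq).
move=> y Uy; apply/(orth_cspan I_cs); split.
  by apply: (zero (xi (G p) 0)) => // x; exact: mem_cspan.
apply: (zero (fun y => xi (G p) 0 y *m I)) => // [|x]; first exact: smooth_mulmx.
by apply: cspan_stable => //; exact: mem_cspan.
Qed.

(** The rotation field is known to be smooth only along smooth sections, so v is first extended to a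
    section [s] of Lambda near p. *)
Lemma Lambda_rotation theta A p v : rotation_field g N1bar theta A ->
  Lambda g N1bar p v -> v *m A p = v *m cexp I theta.
Proof.
move=> rA Lv; have [_ sA _] := rA; have [/(_ p)[_ [U [e1 [e2 [[oU Up] UC s1 s2 NE]]]]] _] := N1barP.
have NT y w : U y -> w \in in_chart p N1bar y -> orth (cspan I (xi (G p) 0 y)) w.
  move=> Uy; rewrite NE // span_cons span_seq1 => /memv_addP[_ /vlineP[a ->] [_ /vlineP[b ->] ->]].
  apply: orthD; apply: orthZ.
    apply: (N1bar_section_orth oU UC s1) => // x Ux.
    by rewrite NE // memv_span // mem_head.
  apply: (N1bar_section_orth oU UC s2) => // x Ux.
  by rewrite NE // memv_span // inE mem_head orbT.
have oscE y : osculating I (G p) 1 y = cspan I (xi (G p) 0 y) by rewrite /osculating /= add0v.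
(* The tangent part is removed first, then the part in [N1bar]. As [N1bar] is orthogonal to the
   tangent plane, the second projection does not undo the first. At p both fix v. *)
pose t y := perp_proj (osculating I (G p) 1 y) v.
pose s y := perp_proj <<[:: e1 y; e2 y]>>%VS (t y).
have st : smooth_on U t.
  have nz i y : (i < 1)%N -> U y -> flag_perp I (fun j => xi (G p) j y) i != 0.
    rewrite ltnS leqn0 => /eqP-> /UC/x0; rewrite /flag_perp perp_proj_id // => w.
    by rewrite memv0 => /eqP->; rewrite dot0r.
  have [//] := csection_perp (f := fun=> v) I_cs oU
    (fun i _ => smooth_sub UC (smooth_xi (sG p) i)) nz (@smooth_cst _ _ _ U v).
have ss : smooth_on U s.
  apply: smooth_perp_plane => // y Uy; rewrite -NE //.
  by case: N1barP => /(_ (chart_inv (chart_at p) y))[].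
have Ls y : U y -> in_chart p (Lambda g N1bar) y (s y).
  move=> Uy; split; last first.
    by rewrite -[N1bar _]/(in_chart p N1bar y) NE //; exact: perp_proj_orth.
  rewrite tangent_in_chart; last exact: UC.
  rewrite -(subKr (t y) (s y)); apply: orthB.
    by rewrite -oscE; exact: perp_proj_orth.
  by apply: NT => //; rewrite NE //; exact: perp_proj_mem.
have sp0 : s (coord p) = v.
  have [vT vN] := Lv.
  have tv : t (coord p) = v.
    apply: perp_proj_id; rewrite oscE -tangent_in_chart ?chart_inv_coord //.
    exact: cod_coord.
  by rewrite /s tv perp_proj_id // -NE // /in_chart /= chart_inv_coord.
have c0 : s (coord p) *m in_chart p A (coord p) - s (coord p) *m cexp I theta = 0.
  apply: (@dense_zero _ p U (fun y => s y *m in_chart p A y - s y *m cexp I theta)) => //.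
    move=> y Uy; apply: (smooth_continuous _ Uy); apply: smooth_sub_row => //.
      exact: sA.
    exact: smooth_mulmx.
  move=> y Uy gq; apply/eqP; rewrite subr_eq0; apply/eqP.
  exact: (nondegenerate_rotation rA gq (Ls y Uy)).
move: c0; rewrite sp0 /in_chart /= chart_inv_coord => /eqP; rewrite subr_eq0 => /eqP//.
Qed.
End RotationField.

(** * Piecewise smooth curves and line integrals *)

Section Step.
Context {R : realType}.
Implicit Types (s t h k d : R).

(** The error of the difference quotient is at most C |h|. *)
Lemma is_derive_quadratic (f : R -> R) t d (C : R) :
  (forall h, `|f (h + t) - f t - d * h| <= C * h ^+ 2) -> is_derive t (1 : R) f d.
Proof.
move=> H; suff fd : (fun h => h^-1 *: ((f \o shift t) (h *: (1 : R)) - f t)) @ 0^' --> d.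
  by split; [apply/cvg_ex; exists d | exact: cvg_lim].
have C0 : 0 <= C.
  by have := H 1; rewrite expr1n !mulr1; apply: le_trans (normr_ge0 _).
apply/cvgrPdist_le => e e0; near=> h.
have h0 : h != 0 by near: h; exact: nbhs_dnbhs_neq.
have -> : h *: (1 : R) = h by exact: mulr1.
rewrite -[X in `|d - X|]/(h^-1 * (f (h + t) - f t)).
have -> : d - h^-1 * (f (h + t) - f t) = - (h^-1 * (f (h + t) - f t - d * h)) by field.
rewrite normrN normrM normfV ler_pdivrMl ?normr_gt0 //.
apply: le_trans (H h) _; rewrite -real_normK ?num_real // expr2 mulrCA ler_wpM2l //.
(* C may be 0, hence the division by C + 1. *)
have : `|h| <= e / (C + 1).
  by near: h; apply: dnbhs0_le; rewrite divr_gt0 // ltr_wpDl.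
rewrite ler_pdivlMr ?ltr_wpDl // => he; apply: le_trans he.
by rewrite mulrC ler_wpM2l // lerDl.
Unshelve. all: by end_near. Qed.

Definition pospart k t : R := Num.max (t - k) 0.

Lemma is_derive_sqr_pospart k t :
  is_derive t (1 : R) (fun x => pospart k x ^+ 2) (2 * pospart k t).
Proof.
apply: (@is_derive_quadratic _ _ _ 1) => h; rewrite /pospart mul1r ler_norml !expr2.
by case: (leP (h + t - k) 0); case: (leP (t - k) 0) => h1 h2;
  rewrite ?mulr0 ?mul0r; apply/andP; split; nra.
Qed.

(* A C^1 function that is 0 on (-oo, 0] and 1 on [1, +oo). *)
Definition step t : R :=
  2 * pospart 0 t ^+ 2 - 4 * pospart (1 / 2) t ^+ 2 + 2 * pospart 1 t ^+ 2.

(** A tent: 4 t on [0, 1/2], 4 (1 - t) on [1/2, 1] and 0 elsewhere. Its integral is 1, whence the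
    coefficients 2, -4, 2 of [step]. *)
Definition dstep t : R :=
  2 * (2 * pospart 0 t) - 4 * (2 * pospart (1 / 2) t) + 2 * (2 * pospart 1 t).

Lemma is_derive_step t : is_derive t (1 : R) step (dstep t).
Proof.
have h k := is_derive_sqr_pospart k t.
exact: is_deriveD.
Qed.

Lemma continuous_dstep : continuous dstep.
Proof.
have c k : continuous (fun t => 2 * pospart k t).
  move=> t; apply: cvgM; first exact: cvg_cst.
  apply: (@continuous_max _ _ (fun t => t - k) (cst 0)); last exact: cvg_cst.
  by apply: cvgB; [exact: cvg_id | exact: cvg_cst].
move=> t; apply: cvgD; last by apply: cvgM; [exact: cvg_cst | exact: c].
by apply: cvgB; apply: cvgM; [exact: cvg_cst | exact: c | exact: cvg_cst | exact: c].
Qed.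

Lemma step0 t : t <= 0 -> step t = 0.
Proof.
move=> t0; rewrite /step /pospart !max_r; [ring|lra|lra|lra].
Qed.

Lemma step1 t : 1 <= t -> step t = 1.
Proof.
move=> t0; rewrite /step /pospart !max_l; [lra|lra|lra|lra].
Qed.

Lemma step_itv t : 0 <= step t <= 1.
Proof.
rewrite /step /pospart !expr2; case: (leP (t - 0) 0) => h0; case: (leP (t - 1 / 2) 0) => h1;
  case: (leP (t - 1) 0) => h2; apply/andP; split; nra.
Qed.
End Step.

(** * C^1 maps on the real line *)

Section CurveComposition.
Context {R : realType} {m N : nat}.
Implicit Types (c : R -> 'rV[R]_m) (f : 'rV[R]_m -> 'rV[R]_N).

(** A property of the germ of c at s, so that curves can be glued where they agree. *)
Definition C1_at (W : normedModType R) (c : R -> W) (s : R) :=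
  (\forall t \near s, derivable c t 1) /\ {for s, continuous (derive1 c)}.

Lemma derive1_comp_row U c f s : smooth_on U f -> U (c s) -> derivable c s 1 ->
  derivable (f \o c) s 1 /\ derive1 (f \o c) s = 'D_(derive1 c s) f (c s).
Proof.
move=> sf Us /derivable1_diffP dc; have df := smooth_diff sf Us; split.
  exact/derivable1_diffP/differentiable_comp.
by rewrite !derive1E derive_comp.
Qed.

Lemma C1_at_comp U c f s : open U -> smooth_on U f -> U (c s) -> C1_at c s ->
  C1_at (f \o c) s.
Proof.
move=> oU sf Us [dc cc].
have cs : {for s, continuous c}.
  exact/differentiable_continuous/derivable1_diffP/(nbhs_singleton dc).
have nU : \forall t \near s, U (c t) by exact: cs (open_nbhs_nbhs (conj oU Us)).
have e : \forall t \near s, derivable (f \o c) t 1 /\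
    \sum_l derive1 c t 0 l *: 'D_(delta_mx 0 l) f (c t) = derive1 (f \o c) t.
  near=> t; have Ut : U (c t) by near: t.
  have dt : derivable c t 1 by near: t.
  have [d ->] := derive1_comp_row sf Ut dt; split=> //.
  by rewrite [RHS]derive_rowE //; exact: (smooth_diff sf Ut).
split; first by apply: filterS e => t [].
apply: (@continuous_near_eq _ _ (fun t => \sum_l derive1 c t 0 l *: 'D_(delta_mx 0 l) f (c t))).
  by apply: filterS e => t [].
have -> : (fun t => \sum_l derive1 c t 0 l *: 'D_(delta_mx 0 l) f (c t)) =
  \sum_l (fun t => derive1 c t 0 l *: 'D_(delta_mx 0 l) f (c t)).
  by apply/funext => t; rewrite fct_sumE.
apply: (@big_ind _ (fun h : R -> 'rV[R]_N => {for s, continuous h})).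
- exact: cvg_cst.
- by move=> h1 h2 c1 c2; exact: cvgD c1 c2.
- move=> l _; apply: cvgZ; first exact: ((continuous_row _ _).1 cc l).
  exact: (@continuous_comp _ _ _ c ('D_(delta_mx 0 l) f) s cs
    (smooth_continuous (smooth_derive _ sf) Us)).
Unshelve. all: by end_near. Qed.

Lemma C1_at_near_eq (W : normedModType R) (c c' : R -> W) s :
  (\forall t \near s, c t = c' t) -> C1_at c s -> C1_at c' s.
Proof.
move=> ne [dc cc]; pose B := [set t | c t = c' t]^°.
have oB : open B by exact: open_interior.
have Bs : B s by exact: ne.
have nB : \forall t \near s, B t by exact: (open_nbhs_nbhs (conj oB Bs)).
have near_at t : B t -> \forall x \near t, c x = c' x.
  by move=> Bt; apply: filterS (open_nbhs_nbhs (conj oB Bt)) => x /interior_subset.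
split.
  near=> t; have Bt : B t by near: t.
  by apply: (near_eq_derivable (near_at t Bt)); near: t.
apply: continuous_near_eq cc; apply: filterS nB => t Bt.
by rewrite !derive1E; apply: near_eq_derive; exact: near_at.
Unshelve. all: by end_near. Qed.

Lemma derive1_affine (W : normedModType R) (c : R -> W) (a b t : R) :
  derivable c (a * t + b) 1 ->
  derivable (fun t => c (a * t + b)) t 1 /\
  a *: derive1 c (a * t + b) = derive1 (fun t => c (a * t + b)) t.
Proof.
move=> /derivable1_diffP dc; pose l (t : R) : R := a * t + b.
have dl : is_derive t (1 : R) l a.
  have -> : l = (a *: id) + cst b by apply/funext => x.
  apply: is_derive_eq; rewrite addr0; exact: mulr1.
have Dl : differentiable l t by apply/derivable1_diffP; case: dl.
split; first exact/derivable1_diffP/(differentiable_comp Dl).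
have dl1 : 'd l t 1 = a by rewrite -deriveE //; case: dl.
have E : 'd (c \o l) t 1 = 'd c (l t) ('d l t 1).
  exact: (congr1 (fun F : R -> W => F 1) (diff_comp Dl dc)).
rewrite !derive1E (deriveE _ dc) [RHS](deriveE _ (differentiable_comp Dl dc)).
apply: etrans (esym E); rewrite dl1 -linearZ; congr ('d c _ _); exact: mulr1.
Qed.

Lemma C1_at_affine (W : normedModType R) (c : R -> W) (a b s : R) :
  C1_at c (a * s + b) -> C1_at (fun t => c (a * t + b)) s.
Proof.
move=> [dc cc].
have cl : {for s, continuous (fun t : R => a * t + b)}.
  by apply: cvgD; [apply: cvgM; [exact: cvg_cst | exact: cvg_id] | exact: cvg_cst].
have nd : \forall t \near s, derivable c (a * t + b) 1 by exact: (cl _ dc).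
split; first by apply: filterS nd => t /derive1_affine[].
apply: (@continuous_near_eq _ _ (fun t => a *: derive1 c (a * t + b))).
  by apply: filterS nd => t /derive1_affine[].
apply: cvgZ; first exact: cvg_cst.
exact: (@continuous_comp _ _ _ (fun t : R => a * t + b) (derive1 c) s cl cc).
Qed.
End CurveComposition.

(** * Joining points by C^1 curves *)

Section Curves.
Context {R : realType} {L : oriented_riemannian_surface R}.
Implicit Types (p q r : L) (c : R -> L) (s t a b : R).

Definition C1_curve_at c t := {for t, continuous c} /\
  forall p, chart_dom (chart_at p) (c t) -> C1_at (chart_map (chart_at p) \o c) t.

Lemma C1_curve_at_near c p t : {for t, continuous c} -> chart_dom (chart_at p) (c t) ->
  \forall s \near t, chart_dom (chart_at p) (c s).
Proof.
move=> cc dt; exact: cc (open_nbhs_nbhs (conj (chart_dom_open _) dt)).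
Qed.

Lemma C1_curveP c : C1_curve c <-> forall t, C1_curve_at c t.
Proof.
split=> [[cc dc] t|h].
  split=> [|p dt]; first exact: cc.
  split; last by have [] := dc p t dt.
  by apply: filterS (C1_curve_at_near (cc t) dt) => s /dc[].
split=> [t|p t dt]; first by have [] := h t.
by have [_ /(_ p dt) [/nbhs_singleton]] := h t.
Qed.

Lemma C1_curve_at_eq c c' t : (\forall s \near t, c s = c' s) ->
  C1_curve_at c t -> C1_curve_at c' t.
Proof.
move=> e [cc dc]; split=> [|p dt]; first exact: continuous_near_eq cc.
apply: C1_at_near_eq (dc p _); last by rewrite (nbhs_singleton e).
by apply: filterS e => s /= ->.
Qed.

Lemma C1_curve_affine c a b : C1_curve c -> C1_curve (fun t => c (a * t + b)).
Proof.
move=> /C1_curveP h; apply/C1_curveP => t; have [cc dc] := h (a * t + b); split.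
  apply: (@continuous_comp _ _ _ (fun t => a * t + b)) => //.
  by apply: cvgD; [apply: cvgM; [exact: cvg_cst | exact: cvg_id] | exact: cvg_cst].
by move=> p /dc; exact: C1_at_affine.
Qed.

Lemma C1_curve_cst p : C1_curve (fun _ : R => p).
Proof.
apply/C1_curveP => t; split=> [|q _]; first exact: cvg_cst.
have e : derive1 (chart_map (chart_at q) \o (fun _ : R => p)) = fun=> 0.
  by apply/funext => s; rewrite derive1E; exact: derive_cst.
by split; [apply: filterS filterT => s _; exact: derivable_cst | rewrite e; exact: cvg_cst].
Qed.

(** [step] spreads a segment over the whole line, at rest before 0 and after 1 and with continuous
    velocity. *)
Lemma C1_curve_chart p (y u : 'rV[R]_2) :
  (forall t, cod_at p (y + step t *: u)) ->
  C1_curve (fun t => chart_inv (chart_at p) (y + step t *: u)).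
Proof.
move=> hc; pose l t := y + step t *: u.
have dl t : is_derive t (1 : R) l (dstep t *: u).
  have ds := is_derive_step t; split.
    by apply: derivableD; [exact: derivable_cst | apply/derivable1_diffP/differentiableZl/derivable1_diffP; case: ds].
  rewrite (@deriveD _ _ _ (cst y) (fun t => step t *: u)); last first.
  - by apply/derivable1_diffP/differentiableZl/derivable1_diffP; case: ds.
  - exact: derivable_cst.
  rewrite derive_cst add0r derive_scale.
  - rewrite derive_cst scaler0 addr0; congr (_ *: _); by case: ds.
  - by apply/derivable1_diffP; case: ds.
  - exact: differentiable_cst.
have Cl t : C1_at l t.
  split; first by apply: filterS filterT => s _; case: (dl s).
  have -> : derive1 l = fun s => dstep s *: u.
    by apply/funext => s; rewrite derive1E; case: (dl s).
  by apply: cvgZr_tmp; exact: continuous_dstep.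
have cl t : {for t, continuous l}.
  by apply/differentiable_continuous/derivable1_diffP; case: (dl t).
apply/C1_curveP => t; split.
  exact: (@continuous_comp _ _ _ l (chart_inv (chart_at p)) t (cl t) (chart_inv_continuous (hc t))).
move=> q dq; apply: (@C1_at_comp _ _ _ (trans_dom p q) l (trans p q)) => //.
- exact: open_trans_dom.
- exact: smooth_trans.
- by split; [exact: hc | exact: dq].
Qed.

(** Curves at rest outside [a, b] can be concatenated without a corner. *)
Definition reach p q := exists a b c, [/\ a < b, C1_curve c,
  forall t, t <= a -> c t = p & forall t, b <= t -> c t = q].

Lemma reach_trans p q r : reach p q -> reach q r -> reach p r.
Proof.
move=> [a [b [c [ab Cc ca cb]]]] [a' [b' [c' [ab' Cc' ca' cb']]]].
(* The shift keeps [d] at q up to time b + 1, while [c] is at q from time b on; the two agree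
   between b and b + 1, where they are glued. *)
pose d t := c' (1 * t + (a' - (b + 1))).
have Cd : C1_curve d by exact: C1_curve_affine.
pose e t := if t <= b then c t else d t.
have e1 t : t < b + 1 -> e t = c t.
  move=> t1; rewrite /e; case: (leP t b) => // bt; rewrite cb ?ltW // /d ca' //; lra.
have e2 t : b < t -> e t = d t by rewrite /e ltNge => /negPf->.
exists a, (b' - a' + (b + 1)), e; split.
- lra.
- apply/C1_curveP => t; have [t1|t1] := ltP t (b + 1).
    apply: (@C1_curve_at_eq c); last exact: ((C1_curveP c).1 Cc t).
    by apply: filterS (lt_nbhsl t1) => s s1; rewrite e1.
  have bt : b < t by lra.
  apply: (@C1_curve_at_eq d); last exact: ((C1_curveP d).1 Cd t).
  by apply: filterS (lt_nbhsr bt) => s s1; rewrite e2.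
- by move=> t ta; rewrite e1 ?ca //; lra.
- by move=> t tb; rewrite e2 /d ?cb' //; lra.
Qed.

(** Both directions are recorded: the first makes the set of reachable points open, the second makes
    it closed. *)
Lemma reach_near p : \forall q \near p, reach p q /\ reach q p.
Proof.
have /nbhs_ballP[e /= e0 eB] := open_nbhs_nbhs (conj (@open_cod _ L p) (cod_coord p)).
have cont : {for p, continuous (chart_map (chart_at p))}.
  exact/chart_map_continuous/chart_at_dom.
have n1 : \forall q \near p, ball (coord p) e (chart_map (chart_at p) q).
  by apply: cont; exact: nbhsx_ballx.
have n2 : \forall q \near p, chart_dom (chart_at p) q.
  exact: (open_nbhs_nbhs (conj (chart_dom_open _) (chart_at_dom p))).
apply: filterS (filterI n1 n2) => q [Bq dq].
pose u := chart_map (chart_at p) q - coord p.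
have Bt t : 0 <= t <= 1 -> cod_at p (coord p + t *: u).
  move=> /andP[t0 t1]; apply: eB.
  move: Bq; rewrite -!ball_normE /= opprD addrA subrr add0r normrN normrZ distrC.
  by apply: le_lt_trans; rewrite ger0_norm // ler_piMl.
have e1 : coord p + 1 *: u = chart_map (chart_at p) q by rewrite scale1r addrC subrK.
split.
  exists 0, 1, (fun t => chart_inv (chart_at p) (coord p + step t *: u)); split=> //.
  - by apply: C1_curve_chart => t; apply: Bt; exact: step_itv.
  - by move=> t t0; rewrite step0 // scale0r addr0 chart_inv_coord.
  - by move=> t t1; rewrite step1 // e1 chart_mapK.
have e2 t : chart_map (chart_at p) q + t *: (- u) = coord p + (1 - t) *: u.
  by rewrite -e1 -addrA scalerN -scalerBl.
exists 0, 1, (fun t => chart_inv (chart_at p) (chart_map (chart_at p) q + step t *: (- u))); split=> //.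
- apply: C1_curve_chart => t; rewrite e2; apply: Bt; have := step_itv t; lra.
- by move=> t t0; rewrite e2 step0 // subr0 e1 chart_mapK.
- by move=> t t1; rewrite e2 step1 // subrr scale0r addr0 chart_inv_coord.
Qed.

(** [associated] integrates along C^1 curves, while [simply_connected] provides continuous ones. The
    points reachable from p form an open and closed set, which contains the connected image of a
    continuous path from p to q. *)
Lemma C1_path p q : simply_connected R L ->
  exists c : R -> L, [/\ C1_curve c, c 0 = p & c 1 = q].
Proof.
move=> [/(_ p q)[k [kc k0 k1]] _].
have oS : open [set r | reach p r].
  rewrite openE => r pr; apply: filterS (reach_near r) => r' [h _].
  exact: reach_trans h.
have cS : closed [set r | reach p r].
  rewrite -openC openE => r npr; apply: filterS (reach_near r) => r' [_ h] pr'.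
  by apply: npr; exact: reach_trans h.
have cI : connected (k @` `[0%R, 1%R]%classic).
  by apply: connected_continuous_connected kc; exact: segment_connected.
have pp : reach p p.
  by exists 0, 1, (fun=> p); split=> //; exact: C1_curve_cst.
have kE := cI (k @` `[0%R, 1%R]%classic `&` [set r | reach p r]).
have [a [b [c [ab Cc ca cb]]]] : reach p q.
  have : (k @` `[0%R, 1%R]%classic) q.
    by exists 1 => //=; rewrite in_itv /= lexx ler01.
  rewrite -kE; first by case.
  - exists p; split=> //; exists 0 => //=; by rewrite in_itv /= lexx ler01.
  - by exists [set r | reach p r].
  - by exists [set r | reach p r].
exists (fun t => c ((b - a) * t + a)); split.
- exact: C1_curve_affine.
- by rewrite mulr0 add0r ca.
- by rewrite mulr1 subrK cb.
Qed.
End Curves.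

(** * The integrals that define the associated family *)

Section Integral.
Context {R : realType} {L : oriented_riemannian_surface R} {n : nat}.
Variables (g : L -> 'rV[R]_n.+2) (I : 'M[R]_n.+2).
Hypothesis g_isom : isometric_immersion g.
Hypothesis I_cs : parallel_complex_structure I.
Hypothesis g_hol : holomorphic g I.

Lemma derive_along_curve (c : R -> L) t : C1_curve c ->
  derivable (g \o c) t 1 /\ derive1 (g \o c) t = Defs.pushforward g (c t) (velocity c t).
Proof.
move=> /C1_curveP/(_ t)[cc dc]; have dt := chart_at_dom (c t).
have [dy _] := dc _ dt.
have [d e] := derive1_comp_row (smooth_G g_isom (c t)) (cod_coord (c t)) (nbhs_singleton dy).
have ne : \forall s \near t, (in_chart (c t) g \o (chart_map (chart_at (c t)) \o c)) s = (g \o c) s.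
  apply: filterS (C1_curve_at_near cc dt) => s ds.
  by rewrite /in_chart /= chart_mapK.
split; first exact: near_eq_derivable ne d.
by rewrite -[RHS]e !derive1E; apply/esym/near_eq_derive.
Qed.

Lemma continuous_derive_along_curve (c : R -> L) t : C1_curve c ->
  {for t, continuous (derive1 (g \o c))}.
Proof.
move=> /C1_curveP/(_ t)[cc dc]; have dt := chart_at_dom (c t).
have Cy := C1_at_comp (@open_cod _ L (c t)) (smooth_G g_isom (c t)) (cod_coord (c t)) (dc _ dt).
have ne : \forall s \near t, (in_chart (c t) g \o (chart_map (chart_at (c t)) \o c)) s = (g \o c) s.
  apply: filterS (C1_curve_at_near cc dt) => s ds.
  by rewrite /in_chart /= chart_mapK.
by have [] := C1_at_near_eq ne Cy.
Qed.

Lemma pushforward_J theta p (u : 'rV[R]_2) :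
  Defs.pushforward g p (cplxJ_theta theta p (coord p) u) = Defs.pushforward g p u *m cexp I theta.
Proof.
rewrite mul_cexp -g_hol /Defs.pushforward /cplxJ_theta derive_dir //.
exact: (smooth_diff (smooth_G g_isom p) (cod_coord p)).
Qed.

(** Fundamental theorem of calculus for [H], whose derivative is continuous because c is C^1. *)
Lemma integral_along_curve theta (c : R -> L) : C1_curve c ->
  \row_(i < n.+2) Rintegral (@lebesgue_measure R) `[0%R, 1%R]%classic
    (fun t => Defs.pushforward g (c t)
      (cplxJ_theta theta (c t) (coord (c t)) (velocity c t)) 0 i) =
  (g (c 1) - g (c 0)) *m cexp I theta.
Proof.
move=> Cc; pose H t := (g \o c) t *m cexp I theta.
have dgc t : differentiable (g \o c) t.
  by apply/derivable1_diffP; have [] := derive_along_curve t Cc.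
have DH t : differentiable H t by exact: differentiable_mulmx.
have cH t : {for t, continuous H} by exact: differentiable_continuous.
have dH t : derive1 H t = derive1 (g \o c) t *m cexp I theta.
  by rewrite !derive1E derive_mulmx.
apply/rowP => i; rewrite mxE.
have -> : (fun t => Defs.pushforward g (c t)
      (cplxJ_theta theta (c t) (coord (c t)) (velocity c t)) 0 i) =
    (fun t => derive1 H t 0 i).
  apply/funext => t; rewrite dH pushforward_J.
  by have [_ ->] := derive_along_curve t Cc.
have cdH t : {for t, continuous (fun s => derive1 H s 0 i)}.
  apply: (continuous_row _ _).1; have -> : derive1 H = fun s => derive1 (g \o c) s *m cexp I theta.
    by apply/funext.
  apply: (@continuous_comp _ _ _ (derive1 (g \o c)) (mulmxr (cexp I theta))).
    exact: continuous_derive_along_curve.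
  by apply/differentiable_continuous/differentiable_mulmx.
have cHi t : {for t, continuous (fun s => H s 0 i)} by exact: (continuous_row _ _).1.
rewrite /Rintegral (@continuous_FTC2 _ _ (fun t => H t 0 i)) //.
- by rewrite /= /H mulmxBl !mxE.
- by apply: continuous_subspaceT => t; exact: cdH.
- split.
  + move=> t _; apply/derivable1_diffP; exact: (differentiable_row _ _).1.
  + by apply: cvg_at_right_filter; exact: cHi.
  + by apply: cvg_at_left_filter; exact: cHi.
- move=> t _; rewrite (derive1E (fun s => H s 0 i)) derive1E.
  exact: (esym (derive_row _ i (DH t))).
Qed.
End Integral.

Lemma cexp_isometry (R : realType) (N : nat) (I : 'M[R]_N) theta :
  parallel_complex_structure I ->
  forall v : 'rV[R]_N, dot (v *m cexp I theta) (v *m cexp I theta) = dot v v.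
Proof.
move=> I_cs v; rewrite !mul_cexp !dot_lin (dotII I_cs) dotI0 // (dotC (v *m I)) dotI0 //.
by rewrite -[RHS]mul1r -(cos2Dsin2 theta); ring.
Qed.

Theorem theorem6 (R : realType) (n : nat) (n_ge4 : (4 <= n)%N)
  (L : oriented_riemannian_surface R) (L_sc : simply_connected R L)
  (g : L -> 'rV[R]_n.+2)
  (g_isom : isometric_immersion g)
  (g_iso : one_isotropic g)
  (g_subst : substantial g)
  (N1bar : L -> {vspace 'rV[R]_n.+2})
  (N1barP : smooth_extension_of_N1 g N1bar)
  (p0 : L) (g_ : R -> L -> 'rV[R]_n.+2)
  (g_P : forall theta, associated g p0 theta (g_ theta))
  (R_ : R -> L -> 'M[R]_n.+2)
  (R_P : forall theta, rotation_field g N1bar theta (R_ theta))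
  (g_hol : exists I : 'M[R]_n.+2,
     parallel_complex_structure I /\ holomorphic g I) :
  forall theta : R, 0 <= theta < pi ->
    exists tau : 'rV[R]_n.+2 -> 'rV[R]_n.+2,
      euclidean_isometry tau /\
      forall x : L * 'rV[R]_n.+2, total_space g N1bar x ->
        ruled_map (g_ theta) x = tau (ruled_map g (S_map (R_ (- theta)) x)).
Proof.
move=> theta _; have [I [I_cs hol]] := g_hol.
(* The ambient space carries a complex structure, so n is even; with h = n / 2 its complex dimension
   is h + 1. *)
have nE : n.+2 = (n./2).+1.*2.
  by rewrite doubleS -[in LHS](even_halfK (n := n)) //; have := complex_structure_even I_cs; rewrite /= negbK.
have h2 : (2 <= n./2)%N by have := half_leq n_ge4.
exists (fun y => (y - g p0) *m cexp I theta); split.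
  move=> x y; rewrite /enorm -mulmxBl (_ : x - g p0 - (y - g p0) = x - y); last by rewrite opprB addrA subrK.
  by rewrite cexp_isometry.
move=> [p v] Lv; rewrite /ruled_map /=.
have [c [Cc c0 c1]] := C1_path p0 p L_sc.
have -> : g_ theta p = (g p - g p0) *m cexp I theta.
  rewrite -c1 (g_P theta c Cc c0) -[in RHS]c0; exact: integral_along_curve.
(* On the fibre, R_(- theta) is multiplication by T_(- theta), which the factor T_theta of the
   isometry cancels. *)
rewrite (Lambda_rotation g_isom I_cs hol g_subst N1barP nE h2 (R_P (- theta)) Lv).
have := cexpK I_cs (- theta) v; rewrite opprK => K.
by rewrite [in RHS]addrAC [RHS]mulmxDl K.
Qed.
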